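(* Let $(\mathcal{R},\zeta,\mu)$ be a small bimonoidal category with anti-involution. Then the maps $\tau\colon BGL_n(\mathcal{R})\to \tilde{B}GL_n(\mathcal{R})$, $n\geq 0$, give rise to an involution on $\mathcal{K}(\mathcal{R})=\Omega B\left(\bigsqcup_{n\geq 0}|BGL_n(\mathcal{R})|\right)$.
   Context: **Bimonoidal category.** A (strict) bimonoidal category $(\mathcal{R},\oplus,0_{\mathcal R},c_\oplus,\otimes,1_{\mathcal R})$ consists of a permutative category $(\mathcal{R},\oplus,0_{\mathcal R},c_\oplus)$ (strictly associative and unital symmetric monoidal) and a strict monoidal category $(\mathcal{R},\otimes,1_{\mathcal R})$ on the same underlying category, with natural isomorphisms $d_\ell\colon A\otimes B\oplus A'\otimes B\to (A\oplus A')\otimes B$, assumed to be the identity, and $d_r\colon A\otimes B\oplus A\otimes B'\to A\otimes(B\oplus B')$, satisfying the axioms of Elmendorf–Mandell (''Rings, modules and algebras in infinite loop space theory'', Def. 3.3): $0_{\mathcal R}\otimes A=0_{\mathcal R}=A\otimes 0_{\mathcal R}$; $d_\ell,d_r$ are compatible with the associativity of $\oplus$, with $c_\oplus$, and with the associativity of $\otimes$; $(d_r\otimes \mathrm{id})\circ d_\ell=(\mathrm{id}\otimes d_\ell)\circ d_r$ as maps $A\otimes B\otimes C\oplus A\otimes B'\otimes C\to A\otimes(B\oplus B')\otimes C$; and the two ways of going from $A\otimes B\oplus A\otimes B'\oplus A'\otimes B\oplus A'\otimes B'$ to $(A\oplus A')\otimes(B\oplus B')$ agree (using $\mathrm{id}\oplus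 c_\oplus\oplus\mathrm{id}$). **Anti-involution.** An anti-involution on $\mathcal R$ is a functor $\zeta\colon\mathcal R\to\mathcal R$ with $\zeta\circ\zeta=\mathrm{id}$ together with natural isomorphisms $\mu_{A,B}\colon\zeta(A\otimes B)\to\zeta(B)\otimes\zeta(A)$ such that: (1) $\zeta$ is strictly symmetric monoidal with respect to $(\oplus,0_{\mathcal R},c_\oplus)$; (2) $\zeta(1_{\mathcal R})=1_{\mathcal R}$ and $\mu_{1_{\mathcal R},A}=\mathrm{id}_{\zeta(A)}=\mu_{A,1_{\mathcal R}}$; (3) $(\mathrm{id}\otimes\mu_{A,B})\circ\mu_{A\otimes B,C}=(\mu_{B,C}\otimes\mathrm{id})\circ\mu_{A,B\otimes C}$; (4) $\mu_{A,B\oplus C}\circ\zeta(d_r)=d_\ell\circ(\mu_{A,B}\oplus\mu_{A,C})$ and $\mu_{A\oplus B,C}\circ\zeta(d_\ell)=d_r\circ(\mu_{A,C}\oplus\mu_{B,C})$. **Matrices.** $M_n(\mathcal R)$ is the category whose objects (morphisms) are $n\times n$-matrices of objects (morphisms) of $\mathcal R$. It is monoidal under $(A\cdot B)_{i,j}=\bigoplus_{k=1}^nA_{i,k}\otimes B_{k,j}$, with unit $E_n$ ($1_{\mathcal R}$ on the diagonal, $0_{\mathcal R}$ elsewhere). $\pi_0(\mathcal R)$ is the rig of path components and $Gr(\pi_0(\mathcal R))$ its additive group completion, a ring. $GL_n(\mathcal R)$ is the full (monoidal) subcategory of $M_n(\mathcal R)$ of those $A$ whose matrix of classes $([A_{i,j}])$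 is invertible over $Gr(\pi_0(\mathcal R))$. Transposition is $A^t_{i,j}=A_{j,i}$ on objects and likewise on morphisms; $\zeta$ is applied to matrices entrywise; $\mu\colon\zeta(A\cdot B)^t\to\zeta(B)^t\cdot\zeta(A)^t$ denotes the isomorphism with $(i,j)$-entry $\bigoplus_k\mu_{A_{j,k},B_{k,i}}$. **Bar construction.** For a monoidal category $(\mathcal C,\cdot,1)$, $B(\mathcal C)$ is the simplicial category where an object of $B_q(\mathcal C)$ consists of objects $A^{ij}$ of $\mathcal C$ ($0\le i<j\le q$) and isomorphisms $\phi^{ijk}\colon A^{ij}\cdot A^{jk}\to A^{ik}$ ($i<j<k$) such that for $i<j<k<l$ one has $\phi^{ikl}\circ(\phi^{ijk}\cdot\mathrm{id})=\phi^{ijl}\circ(\mathrm{id}\cdot\phi^{jkl})$ modulo the associativity isomorphism $(A^{ij}\cdot A^{jk})\cdot A^{kl}\cong A^{ij}\cdot(A^{jk}\cdot A^{kl})$. Morphisms $(A,\phi)\to(B,\psi)$ are families $f^{ij}\colon A^{ij}\to B^{ij}$ with $f^{ik}\phi^{ijk}=\psi^{ijk}(f^{ij}\cdot f^{jk})$. The simplicial structure is by precomposition with maps in $\Delta$, with the convention $A^{ii}=1$. **The simplicial category $\tilde B$ and the map $\tau$.** Let $r\colon\Delta^{op}\to\Delta^{op}$ be the identity on objects and send $f=g^{op}\colon[p]\to[q]$ to the opposite of the monotone map $[q]\to[p]$, $i\mapsto p-g(q-i)$. $\tilde BGL_n(\mathcal R)$ is the composite of $r$ with $BGL_n(\mathcal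 R)\colon\Delta^{op}\to\mathrm{CAT}$. The map $\tau\colon BGL_n(\mathcal R)\to\tilde BGL_n(\mathcal R)$ sends $(A^{ij},\phi^{ijk})$ in simplicial degree $q$ to $(B^{ij},\tau(\phi)^{ijk})$ with $B^{ij}=(\zeta(A^{q-j,q-i}))^t$ and $\tau(\phi)^{ijk}=(\zeta(\phi^{q-k,q-j,q-i}))^t\circ\mu^{-1}\colon B^{ij}\cdot B^{jk}\to B^{ik}$, and sends morphisms $(f^{ij})$ to $((\zeta(f^{q-j,q-i}))^t)$. The realizations $|\tilde BGL_n(\mathcal R)|$ and $|BGL_n(\mathcal R)|$ are identified by reversing the coordinates in the standard simplices. **$K$-theory.** $\mathcal K(\mathcal R)=\Omega B(\bigsqcup_{n\ge0}|BGL_n(\mathcal R)|)$, where $\bigsqcup_n|BGL_n(\mathcal R)|$ is a topological monoid under block sum of matrices and $\Omega B$ denotes group completion.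
   Formalization: ζ∘ζ = id is taken to include the structure isomorphisms: μ_{ζB,ζA}∘ζ(μ_{A,B}) = id is also assumed, since otherwise τ∘τ ≠ id; and 0⊗A = 0 = A⊗0 is taken as an equality of functors (also on morphisms). *)

(* Defs.v *)
From HB Require Import structures.
From Stdlib Require Import Relation_Operators.
From mathcomp Require Import all_boot all_order all_algebra.
From mathcomp Require Import all_classical all_reals.
From mathcomp Require Import topology normedtype continuous_path.

Set Implicit Arguments.
Unset Strict Implicit.
Unset Printing Implicit Defensive.

Import Order.TTheory GRing.Theory Num.Theory.
Import numFieldNormedType.Exports.

Local Open Scope ring_scope.
Local Open Scope quotient_scope.

Definition generated (T : Type) (e : T -> T -> Prop) : rel T :=
  fun x y => `[< clos_refl_sym_trans T e x y >].

Lemma generated_equiv (T : Type) (e : T -> T -> Prop) :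
  equiv_class_of (generated e).
Proof.
split=> [x|x y|y x z].
- exact/asboolP/rst_refl.
- by apply: asbool_equiv_eq; split; apply: rst_sym.
- by move=> /asboolP xy /asboolP yz; apply/asboolP; apply: rst_trans xy yz.
Qed.

Canonical generated_equiv_rel (T : Type) (e : T -> T -> Prop) :=
  EquivRelPack (generated_equiv e).

(* Small categories are presented with a single type of morphisms, equipped
   with source and target maps.  All the strict equalities between objects
   below (strict associativity, zeta being an involution, ...) can then be
   used without transporting morphisms along them.  [comp g f] is g o f; it is
   meaningful only when [cod f = dom g], and no axiom concerns its value
   otherwise. *)
Record cat := Cat {
  ob : Type;
  mor : Type;
  dom : mor -> ob;
  cod : mor -> ob;
  idm : ob -> mor;
  comp : mor -> mor -> mor;
  dom_idm : forall a, dom (idm a) = a;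
  cod_idm : forall a, cod (idm a) = a;
  dom_comp : forall g f, cod f = dom g -> dom (comp g f) = dom f;
  cod_comp : forall g f, cod f = dom g -> cod (comp g f) = cod g;
  comp_idl : forall f, comp (idm (cod f)) f = f;
  comp_idr : forall f, comp f (idm (dom f)) = f;
  compA : forall h g f, cod f = dom g -> cod g = dom h ->
    comp h (comp g f) = comp (comp h g) f }.

Arguments idm {c}.
Arguments dom {c}.
Arguments cod {c}.
Arguments comp {c}.

Notation "g \oc f" := (comp g f) (at level 50, left associativity).

Definition hom (C : cat) (a b : ob C) (f : mor C) := dom f = a /\ cod f = b.

Definition inverse_of (C : cat) (f g : mor C) :=
  [/\ hom (cod f) (dom f) g, g \oc f = idm (dom f) & f \oc g = idm (cod f)].

Definition is_iso (C : cat) (f : mor C) := exists g, inverse_of f g.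

Record functor (C D : cat) := Functor {
  fob :> ob C -> ob D;
  fmor : mor C -> mor D;
  fmor_hom : forall f, hom (fob (dom f)) (fob (cod f)) (fmor f);
  fmor_id : forall a, fmor (idm a) = idm (fob a);
  fmor_comp : forall g f, cod f = dom g ->
    fmor (g \oc f) = fmor g \oc fmor f }.

Record strict_monoidal (C : cat) := StrictMonoidal {
  tob : ob C -> ob C -> ob C;
  tmor : mor C -> mor C -> mor C;
  tone : ob C;
  tmor_hom : forall f g,
    hom (tob (dom f) (dom g)) (tob (cod f) (cod g)) (tmor f g);
  tmor_id : forall a b, tmor (idm a) (idm b) = idm (tob a b);
  tmor_comp : forall f f' g g', cod f = dom f' -> cod g = dom g' ->
    tmor (f' \oc f) (g' \oc g) = tmor f' g' \oc tmor f g;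
  tobA : associative tob;
  tob1l : left_id tone tob;
  tob1r : right_id tone tob;
  tmorA : associative tmor;
  tmor1l : left_id (idm tone) tmor;
  tmor1r : right_id (idm tone) tmor }.

Record permutative (C : cat) := Permutative {
  padd :> strict_monoidal C;
  psym : ob C -> ob C -> mor C;
  psym_hom : forall a b, hom (tob padd a b) (tob padd b a) (psym a b);
  psym_nat : forall f g, psym (cod f) (cod g) \oc tmor padd f g =
    tmor padd g f \oc psym (dom f) (dom g);
  psym_inv : forall a b, psym b a \oc psym a b = idm (tob padd a b);
  psym0 : forall a, psym a (tone padd) = idm a;
  psym_hex : forall a b c, psym a (tob padd b c) =
    tmor padd (idm b) (psym a c) \oc tmor padd (psym a b) (idm c) }.

Section Operations.
Variables (C : cat) (P : permutative C) (M : strict_monoidal C).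

Definition oplus := tob P.
Definition oplusm := tmor P.
Definition ozero := tone P.
Definition otimes := tob M.
Definition otimesm := tmor M.
Definition ounit := tone M.

End Operations.

(* The left distributivity isomorphism is the identity: this is
   [otimes_addl] on objects, its naturality is [otimesm_addl], and in the
   coherence axioms it has been erased (those that become trivial are
   omitted).  The equality of 0 (x) A, A (x) 0 and 0 is one of functors of A,
   hence the clauses on morphisms. *)
Record bimonoidal := Bimonoidal {
  bcat :> cat;
  badd : permutative bcat;
  bmul : strict_monoidal bcat;
  dr : ob bcat -> ob bcat -> ob bcat -> mor bcat;
  otimes0l : forall a, otimes bmul (ozero badd) a = ozero badd;
  otimes0r : forall a, otimes bmul a (ozero badd) = ozero badd;
  otimesm0l : forall f, otimesm bmul (idm (ozero badd)) f = idm (ozero badd);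
  otimesm0r : forall f, otimesm bmul f (idm (ozero badd)) = idm (ozero badd);
  otimes_addl : forall a a' b, otimes bmul (oplus badd a a') b =
    oplus badd (otimes bmul a b) (otimes bmul a' b);
  otimesm_addl : forall f f' g, otimesm bmul (oplusm badd f f') g =
    oplusm badd (otimesm bmul f g) (otimesm bmul f' g);
  dr_hom : forall a b b', hom
    (oplus badd (otimes bmul a b) (otimes bmul a b'))
    (otimes bmul a (oplus badd b b')) (dr a b b');
  dr_iso : forall a b b', is_iso (dr a b b');
  dr_nat : forall f g g', dr (cod f) (cod g) (cod g')
      \oc oplusm badd (otimesm bmul f g) (otimesm bmul f g') =
    otimesm bmul f (oplusm badd g g') \oc dr (dom f) (dom g) (dom g');
  dr_oplusA : forall a b b' b'',
    dr a (oplus badd b b') b''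
      \oc oplusm badd (dr a b b') (idm (otimes bmul a b'')) =
    dr a b (oplus badd b' b'')
      \oc oplusm badd (idm (otimes bmul a b)) (dr a b' b'');
  dr_sym : forall a b b',
    dr a b' b \oc psym badd (otimes bmul a b) (otimes bmul a b') =
    otimesm bmul (idm a) (psym badd b b') \oc dr a b b';
  dl_sym : forall a a' b,
    psym badd (otimes bmul a b) (otimes bmul a' b) =
    otimesm bmul (psym badd a a') (idm b);
  dr_otimesA : forall a a' b b', dr (otimes bmul a a') b b' =
    otimesm bmul (idm a) (dr a' b b')
      \oc dr a (otimes bmul a' b) (otimes bmul a' b');
  dr_dl : forall a b b' c, otimesm bmul (dr a b b') (idm c) =
    dr a (otimes bmul b c) (otimes bmul b' c);
  dr_dl_exchange : forall a a' b b',
    dr (oplus badd a a') b b' \oc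
      oplusm badd (oplusm badd (idm (otimes bmul a b))
          (psym badd (otimes bmul a b') (otimes bmul a' b)))
        (idm (otimes bmul a' b')) =
    oplusm badd (dr a b b') (dr a' b b') }.

Local Notation "a <+> b" := (oplus (badd _) a b)
  (at level 50, left associativity).
Local Notation "f <+m> g" := (oplusm (badd _) f g)
  (at level 50, left associativity).
Local Notation "a <*> b" := (otimes (bmul _) a b)
  (at level 40, left associativity).
Local Notation "f <*m> g" := (otimesm (bmul _) f g)
  (at level 40, left associativity).
Local Notation bzero R := (ozero (badd R)).
Local Notation bone R := (ounit (bmul R)).

HB.instance Definition _ (R : bimonoidal) := Monoid.isLaw.Build
  (ob R) (bzero R) (oplus (badd R))
  (@tobA _ (badd R)) (@tob1l _ (badd R)) (@tob1r _ (badd R)).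
HB.instance Definition _ (R : bimonoidal) := Monoid.isLaw.Build
  (mor R) (idm (bzero R)) (oplusm (badd R))
  (@tmorA _ (badd R)) (@tmor1l _ (badd R)) (@tmor1r _ (badd R)).

(* [muV a b] is the inverse of the isomorphism [mu a b].  That zeta o zeta is
   the identity is understood as an equality of functors together with their
   structure isomorphisms: besides [zeta_ob_inv] and [zeta_mor_inv], the
   composite zeta(zeta(a (x) b)) -> zeta(zeta(b) (x) zeta(a)) -> a (x) b of the
   structure isomorphisms is the identity, which is [mu_inv].  This does not
   follow from the other clauses. *)
Record anti_involution (R : bimonoidal) := AntiInvolution {
  zeta : functor R R;
  mu : ob R -> ob R -> mor R;
  muV : ob R -> ob R -> mor R;
  zeta_ob_inv : forall a, zeta (zeta a) = a;
  zeta_mor_inv : forall f, fmor zeta (fmor zeta f) = f;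
  mu_inv : forall a b,
    mu (zeta b) (zeta a) \oc fmor zeta (mu a b) = idm (a <*> b);
  mu_hom : forall a b, hom (zeta (a <*> b)) (zeta b <*> zeta a) (mu a b);
  mu_muV : forall a b, inverse_of (mu a b) (muV a b);
  mu_nat : forall f g, mu (cod f) (cod g) \oc fmor zeta (f <*m> g) =
    (fmor zeta g <*m> fmor zeta f) \oc mu (dom f) (dom g);
  zeta_oplus : forall a b, zeta (a <+> b) = zeta a <+> zeta b;
  zeta_oplusm : forall f g,
    fmor zeta (f <+m> g) = fmor zeta f <+m> fmor zeta g;
  zeta_zero : zeta (bzero R) = bzero R;
  zeta_sym : forall a b,
    fmor zeta (psym (badd R) a b) = psym (badd R) (zeta a) (zeta b);
  zeta_one : zeta (bone R) = bone R;
  mu1l : forall a, mu (bone R) a = idm (zeta a);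
  mu1r : forall a, mu a (bone R) = idm (zeta a);
  muA : forall a b c,
    (idm (zeta c) <*m> mu a b) \oc mu (a <*> b) c =
    (mu b c <*m> idm (zeta a)) \oc mu a (b <*> c);
  mu_dr : forall a b c,
    mu a (b <+> c) \oc fmor zeta (dr a b c) = mu a b <+m> mu a c;
  mu_dl : forall a b c,
    mu (a <+> b) c = dr (zeta c) (zeta a) (zeta b) \oc (mu a c <+m> mu b c) }.

Definition adjacent (C : cat) (a b : {classic ob C}) : Prop :=
  exists f : mor C, hom (a : ob C) (b : ob C) f.

Definition pi0 (R : bimonoidal) := {eq_quot (generated (@adjacent R))}.
HB.instance Definition _ (R : bimonoidal) := Choice.on (pi0 R).

Definition pi0_class (R : bimonoidal) (a : ob R) : pi0 R :=
  \pi_(pi0 R) (a : {classic ob R}).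

Section Pi0.
Variable R : bimonoidal.
Local Notation cls := (@pi0_class R).
Local Notation conn := (clos_refl_sym_trans _ (@adjacent R)).

Lemma pi0_classP (a b : ob R) : reflect (conn a b) (cls a == cls b).
Proof.
apply: (iffP idP); first by move=> /eqP/eqmodP/asboolP.
by move=> ab; apply/eqP/eqmodP/asboolP.
Qed.

Lemma pi0_ind (P : pi0 R -> Prop) : (forall a, P (cls a)) -> forall x, P x.
Proof. by move=> PA x; rewrite -[x]reprK; apply: PA. Qed.

Lemma pi0_mor (f : mor R) : cls (dom f) = cls (cod f).
Proof. by apply/eqP/pi0_classP/rst_step; exists f. Qed.

Lemma pi0_lift (T : Type) (F : ob R -> T) :
  (forall f : mor R, F (dom f) = F (cod f)) ->
  forall a, F (repr (cls a)) = F a.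
Proof.
move=> Ff a; have F_conn x y : conn x y -> F x = F y.
  by elim=> {x y} [x y [f [<- <-]]|//|x y _ ->|x y z _ -> _ ->].
by apply/F_conn/pi0_classP; rewrite {1}/pi0_class reprK.
Qed.

Lemma pi0_lift2 (F : ob R -> ob R -> ob R) :
    (forall f g : mor R, cls (F (dom f) (dom g)) = cls (F (cod f) (cod g))) ->
  forall a b, cls (F (repr (cls a)) (repr (cls b))) = cls (F a b).
Proof.
move=> Ff a b.
rewrite (pi0_lift (F := fun x => cls (F x (repr (cls b))))).
  apply: (pi0_lift (F := fun y => cls (F a y))) => g.
  by rewrite -{1}(dom_idm a) Ff cod_idm.
move=> f; have := Ff f (idm (repr (cls b))).
by rewrite dom_idm cod_idm.
Qed.

Definition pi0_add (x y : pi0 R) : pi0 R := cls (repr x <+> repr y).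
Definition pi0_mul (x y : pi0 R) : pi0 R := cls (repr x <*> repr y).

Lemma pi0_addE a b : pi0_add (cls a) (cls b) = cls (a <+> b).
Proof.
apply: (pi0_lift2 (F := oplus (badd R))) => f g.
rewrite /oplus; have [<- <-] := tmor_hom (badd R) f g; exact: pi0_mor.
Qed.

Lemma pi0_mulE a b : pi0_mul (cls a) (cls b) = cls (a <*> b).
Proof.
apply: (pi0_lift2 (F := otimes (bmul R))) => f g.
rewrite /otimes; have [<- <-] := tmor_hom (bmul R) f g; exact: pi0_mor.
Qed.

Lemma pi0_addA : associative pi0_add.
Proof.
elim/pi0_ind=> a; elim/pi0_ind=> b; elim/pi0_ind=> c.
by rewrite !pi0_addE /oplus tobA.
Qed.

Lemma pi0_addC : commutative pi0_add.
Proof.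
elim/pi0_ind=> a; elim/pi0_ind=> b; rewrite !pi0_addE /oplus.
have [<- <-] := psym_hom (badd R) a b; exact: pi0_mor.
Qed.

Lemma pi0_add0 : left_id (cls (bzero R)) pi0_add.
Proof. by elim/pi0_ind=> a; rewrite pi0_addE /oplus tob1l. Qed.

Lemma pi0_mulA : associative pi0_mul.
Proof.
elim/pi0_ind=> a; elim/pi0_ind=> b; elim/pi0_ind=> c.
by rewrite !pi0_mulE /otimes tobA.
Qed.

Lemma pi0_mul1l : left_id (cls (bone R)) pi0_mul.
Proof. by elim/pi0_ind=> a; rewrite pi0_mulE /otimes tob1l. Qed.

Lemma pi0_mul1r : right_id (cls (bone R)) pi0_mul.
Proof. by elim/pi0_ind=> a; rewrite pi0_mulE /otimes tob1r. Qed.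

Lemma pi0_mulDl : left_distributive pi0_mul pi0_add.
Proof.
elim/pi0_ind=> a; elim/pi0_ind=> b; elim/pi0_ind=> c.
by rewrite !(pi0_mulE, pi0_addE) otimes_addl.
Qed.

Lemma pi0_mulDr : right_distributive pi0_mul pi0_add.
Proof.
elim/pi0_ind=> a; elim/pi0_ind=> b; elim/pi0_ind=> c.
rewrite !(pi0_mulE, pi0_addE).
have [<- <-] := dr_hom a b c; exact/esym/pi0_mor.
Qed.

Lemma pi0_mul0l : left_zero (cls (bzero R)) pi0_mul.
Proof. by elim/pi0_ind=> a; rewrite pi0_mulE otimes0l. Qed.

Lemma pi0_mul0r : right_zero (cls (bzero R)) pi0_mul.
Proof. by elim/pi0_ind=> a; rewrite pi0_mulE otimes0r. Qed.

HB.instance Definition _ := GRing.isPzSemiRing.Build (pi0 R)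
  pi0_addA pi0_addC pi0_add0 pi0_mulA pi0_mul1l pi0_mul1r
  pi0_mulDl pi0_mulDr pi0_mul0l pi0_mul0r.

End Pi0.

Section GroupCompletion.
Variable S : pzSemiRingType.
Implicit Types x y z : S * S.

(* The pair (a, b) stands for the formal difference a - b. *)
Definition gr_equiv (x y : S * S) : bool :=
  `[< exists k, x.1 + y.2 + k = y.1 + x.2 + k >].

Lemma gr_equiv_class : equiv_class_of gr_equiv.
Proof.
split=> [x|x y|y x z].
- by apply/asboolP; exists 0.
- by apply: asbool_equiv_eq; split=> -[k e]; exists k.
- move=> /asboolP[k e] /asboolP[l e']; apply/asboolP.
  exists (y.1 + y.2 + k + l).
  transitivity ((x.1 + y.2 + k) + (y.1 + z.2 + l)).
    by rewrite !addrA (ACl (1 * 4 * 5 * 3 * 2 * 6))%AC.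
  by rewrite e e' !addrA [RHS](ACl (3 * 2 * 5 * 1 * 4 * 6))%AC.
Qed.

Canonical gr_equiv_rel := EquivRelPack gr_equiv_class.

Definition gr := {eq_quot gr_equiv}.
HB.instance Definition _ := Choice.on gr.

Local Notation "[- x ]" := (\pi_gr x) (format "[- x ]").

Lemma grP x y : reflect (exists k, x.1 + y.2 + k = y.1 + x.2 + k)
  ([- x] == [- y]).
Proof.
apply: (iffP idP); first by move=> /eqP/eqmodP/asboolP.
by move=> xy; apply/eqP/eqmodP/asboolP.
Qed.

Lemma gr_ind (P : gr -> Prop) : (forall x, P [- x]) -> forall u, P u.
Proof. by move=> Px u; rewrite -[u]reprK. Qed.

Definition gr_add (u v : gr) : gr :=
  [- ((repr u).1 + (repr v).1, (repr u).2 + (repr v).2)].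
Definition gr_opp (u : gr) : gr := [- ((repr u).2, (repr u).1)].
Definition gr_mul (u v : gr) : gr :=
  [- ((repr u).1 * (repr v).1 + (repr u).2 * (repr v).2,
      (repr u).1 * (repr v).2 + (repr u).2 * (repr v).1)].

Lemma repr_gr x : exists k,
  (repr [- x]).1 + x.2 + k = x.1 + (repr [- x]).2 + k.
Proof. by apply/grP; rewrite reprK. Qed.

Lemma gr_addE x y : gr_add [- x] [- y] = [- (x.1 + y.1, x.2 + y.2)].
Proof.
apply/eqP/grP => /=; have [k e] := repr_gr x; have [l e'] := repr_gr y.
exists (k + l); set a := repr _ in e *; set b := repr _ in e' *.
transitivity ((a.1 + x.2 + k) + (b.1 + y.2 + l)).
  by rewrite !addrA (ACl (1 * 3 * 5 * 2 * 4 * 6))%AC.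
by rewrite e e' !addrA (ACl (1 * 4 * 2 * 5 * 3 * 6))%AC.
Qed.

Lemma gr_oppE x : gr_opp [- x] = [- (x.2, x.1)].
Proof.
apply/eqP/grP => /=; have [k e] := repr_gr x; exists k.
by rewrite [_ + x.1]addrC -e [X in X + k]addrC.
Qed.

Lemma gr_mulE x y : gr_mul [- x] [- y] =
  [- (x.1 * y.1 + x.2 * y.2, x.1 * y.2 + x.2 * y.1)].
Proof.
have [k e] := repr_gr x; have [l e'] := repr_gr y; rewrite /gr_mul.
set a := repr _ in e *; set b := repr _ in e' *.
transitivity ([- (x.1 * b.1 + x.2 * b.2, x.1 * b.2 + x.2 * b.1)]).
  apply/eqP/grP => /=; exists (k * b.1 + k * b.2).
  transitivity ((a.1 + x.2 + k) * b.1 + (x.1 + a.2 + k) * b.2).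
    by rewrite !mulrDl !addrA (ACl (1 * 4 * 5 * 3 * 2 * 6))%AC.
  by rewrite e -[in X in _ + X]e !mulrDl !addrA (ACl (1 * 5 * 4 * 2 * 3 * 6))%AC.
apply/eqP/grP => /=; exists (x.1 * l + x.2 * l).
transitivity (x.1 * (b.1 + y.2 + l) + x.2 * (y.1 + b.2 + l)).
  by rewrite !mulrDr !addrA (ACl (1 * 3 * 5 * 4 * 2 * 6))%AC.
by rewrite e' -[in X in _ + X]e' !mulrDr !addrA (ACl (1 * 5 * 2 * 4 * 3 * 6))%AC.
Qed.

Lemma gr_addA : associative gr_add.
Proof.
elim/gr_ind=> x; elim/gr_ind=> y; elim/gr_ind=> z.
by rewrite !gr_addE /= !addrA.
Qed.

Lemma gr_addC : commutative gr_add.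
Proof.
elim/gr_ind=> x; elim/gr_ind=> y.
by rewrite !gr_addE [x.1 + _]addrC [x.2 + _]addrC.
Qed.

Lemma gr_add0 : left_id [- (0, 0)] gr_add.
Proof. by elim/gr_ind=> -[a b]; rewrite gr_addE /= !add0r. Qed.

Lemma gr_addN : left_inverse [- (0, 0)] gr_opp gr_add.
Proof.
elim/gr_ind=> x; rewrite gr_oppE gr_addE /=; apply/eqP/grP; exists 0 => /=.
by rewrite !addr0 add0r addrC.
Qed.

Lemma gr_mulA : associative gr_mul.
Proof.
elim/gr_ind=> x; elim/gr_ind=> y; elim/gr_ind=> z.
rewrite !gr_mulE /= !mulrDl !mulrDr !mulrA !addrA.
congr (\pi_gr (_, _)).
- by rewrite (ACl (1 * 4 * 2 * 3))%AC.
- by rewrite (ACl (1 * 4 * 2 * 3))%AC.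
Qed.

Lemma gr_mul1l : left_id [- (1, 0)] gr_mul.
Proof.
elim/gr_ind=> -[a b]; rewrite gr_mulE /=.
by rewrite !mul1r !mul0r !addr0.
Qed.

Lemma gr_mul1r : right_id [- (1, 0)] gr_mul.
Proof.
elim/gr_ind=> -[a b]; rewrite gr_mulE /=.
by rewrite !mulr1 !mulr0 addr0 add0r.
Qed.

Lemma gr_mulDl : left_distributive gr_mul gr_add.
Proof.
elim/gr_ind=> x; elim/gr_ind=> y; elim/gr_ind=> z.
rewrite !(gr_mulE, gr_addE) /= !mulrDl.
by congr (\pi_gr (_, _)); rewrite addrACA.
Qed.

Lemma gr_mulDr : right_distributive gr_mul gr_add.
Proof.
elim/gr_ind=> x; elim/gr_ind=> y; elim/gr_ind=> z.
rewrite !(gr_mulE, gr_addE) /= !mulrDr.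
by congr (\pi_gr (_, _)); rewrite addrACA.
Qed.

HB.instance Definition _ := GRing.isPzRing.Build gr
  gr_addA gr_addC gr_add0 gr_addN gr_mulA gr_mul1l gr_mul1r
  gr_mulDl gr_mulDr.

Definition gr_inj (s : S) : gr := [- (s, 0)].

End GroupCompletion.

(* The part of a monoidal structure that enters the bar construction: the
   tensor product functor, the unit and the associativity isomorphisms
   (a . b) . c -> a . (b . c). *)
Record tensor_data (C : cat) := TensorData {
  mob : ob C -> ob C -> ob C;
  mmor : mor C -> mor C -> mor C;
  mone : ob C;
  massoc : ob C -> ob C -> ob C -> mor C;
  mmor_hom : forall f g,
    hom (mob (dom f) (dom g)) (mob (cod f) (cod g)) (mmor f g);
  mmor_id : forall a b, mmor (idm a) (idm b) = idm (mob a b);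
  mmor_comp : forall f f' g g', cod f = dom f' -> cod g = dom g' ->
    mmor (f' \oc f) (g' \oc g) = mmor f' g' \oc mmor f g }.

Section Matrices.
Variables (R : bimonoidal) (n : nat).

Definition Mcomp (g f : 'M[mor R]_n) : 'M[mor R]_n :=
  \matrix_(i, j) (g i j \oc f i j).

Local Notation Mdom := (map_mx (@dom R)).
Local Notation Mcod := (map_mx (@cod R)).
Local Notation Mid := (map_mx (@idm R)).

Let entry (f g : 'M[mor R]_n) : Mcod f = Mdom g ->
  forall i j, cod (f i j) = dom (g i j).
Proof. by move=> /matrixP fg i j; have := fg i j; rewrite !mxE. Qed.

Lemma Mdom_id (a : 'M[ob R]_n) : Mdom (Mid a) = a.
Proof. by apply/matrixP => i j; rewrite !mxE dom_idm. Qed.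

Lemma Mcod_id (a : 'M[ob R]_n) : Mcod (Mid a) = a.
Proof. by apply/matrixP => i j; rewrite !mxE cod_idm. Qed.

Lemma Mdom_comp (g f : 'M[mor R]_n) : Mcod f = Mdom g ->
  Mdom (Mcomp g f) = Mdom f.
Proof.
by move=> /entry fg; apply/matrixP => i j; rewrite !mxE dom_comp.
Qed.

Lemma Mcod_comp (g f : 'M[mor R]_n) : Mcod f = Mdom g ->
  Mcod (Mcomp g f) = Mcod g.
Proof.
by move=> /entry fg; apply/matrixP => i j; rewrite !mxE cod_comp.
Qed.

Lemma Mcomp_idl (f : 'M[mor R]_n) : Mcomp (Mid (Mcod f)) f = f.
Proof. by apply/matrixP => i j; rewrite !mxE comp_idl. Qed.

Lemma Mcomp_idr (f : 'M[mor R]_n) : Mcomp f (Mid (Mdom f)) = f.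
Proof. by apply/matrixP => i j; rewrite !mxE comp_idr. Qed.

Lemma McompA (h g f : 'M[mor R]_n) : Mcod f = Mdom g -> Mcod g = Mdom h ->
  Mcomp h (Mcomp g f) = Mcomp (Mcomp h g) f.
Proof.
by move=> /entry fg /entry gh; apply/matrixP => i j; rewrite !mxE compA.
Qed.

Definition matcat : cat := Cat Mdom_id Mcod_id Mdom_comp Mcod_comp
  Mcomp_idl Mcomp_idr McompA.

Definition Mob (A B : 'M[ob R]_n) : 'M[ob R]_n :=
  \matrix_(i, j) \big[oplus (badd R)/bzero R]_k (A i k <*> B k j).

Definition Mmor (f g : 'M[mor R]_n) : 'M[mor R]_n :=
  \matrix_(i, j) \big[oplusm (badd R)/idm (bzero R)]_k (f i k <*m> g k j).

Definition Mone : 'M[ob R]_n :=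
  \matrix_(i, j) if i == j then bone R else bzero R.

End Matrices.

(* The associativity isomorphism of matrix multiplication.  On the entry
   (i, l) it is the composite
     (+)_k ((+)_j A_ij B_jk) C_kl = (+)_k (+)_j A_ij B_jk C_kl
        -> (+)_j (+)_k A_ij B_jk C_kl -> (+)_j A_ij ((+)_k B_jk C_kl)
   of the identity d_l, a permutation of summands made of instances of the
   symmetry, and iterated instances of d_r. *)
Section Associativity.
Variable R : bimonoidal.

Section OneIndex.
Variable J : Type.

Definition bsum (Y : J -> ob R) (s : seq J) : ob R :=
  \big[oplus (badd R)/bzero R]_(j <- s) Y j.

(* (+)_j Y_j (+) (+)_j Z_j -> (+)_j (Y_j (+) Z_j) *)
Fixpoint interleave (Y Z : J -> ob R) (s : seq J) : mor R :=
  if s is j :: s' then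
    (idm (Y j <+> Z j) <+m> interleave Y Z s') \oc
    (idm (Y j) <+m> psym (badd R) (bsum Y s') (Z j) <+m> idm (bsum Z s'))
  else idm (bzero R).

(* (+)_j (a (x) Y_j) -> a (x) (+)_j Y_j *)
Fixpoint drsum (a : ob R) (Y : J -> ob R) (s : seq J) : mor R :=
  if s is j :: s' then
    dr a (Y j) (bsum Y s') \oc (idm (a <*> Y j) <+m> drsum a Y s')
  else idm (bzero R).

End OneIndex.

(* (+)_(k <- r) (+)_(j <- s) X_kj -> (+)_(j <- s) (+)_(k <- r) X_kj *)
Fixpoint exchange_sum (I J : Type) (X : I -> J -> ob R) (r : seq I)
    (s : seq J) : mor R :=
  if r is k :: r' then
    interleave (X k) (fun j => bsum (X^~ j) r') s \oc
    (idm (bsum (X k) s) <+m> exchange_sum X r' s)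
  else idm (bzero R).

Definition Massoc n (A B C : 'M[ob R]_n) : 'M[mor R]_n :=
  \matrix_(i, l)
    ((\big[oplusm (badd R)/idm (bzero R)]_j
        drsum (A i j) (fun k => B j k <*> C k l) (index_enum 'I_n))
     \oc exchange_sum (fun k j => A i j <*> B j k <*> C k l)
           (index_enum 'I_n) (index_enum 'I_n)).

End Associativity.

Section BigSum.
Variables (R : bimonoidal) (I : Type).

Lemma hom_bigsum (s : seq I) (f : I -> mor R) :
  hom (\big[oplus (badd R)/bzero R]_(i <- s) dom (f i))
      (\big[oplus (badd R)/bzero R]_(i <- s) cod (f i))
      (\big[oplusm (badd R)/idm (bzero R)]_(i <- s) f i).
Proof.
elim/big_rec3: _ => [|i a b g _ [<- <-]]; last exact: tmor_hom.
by split; [exact: dom_idm|exact: cod_idm].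
Qed.

Lemma comp_bigsum (s : seq I) (g f : I -> mor R) :
  (forall i, cod (f i) = dom (g i)) ->
  \big[oplusm (badd R)/idm (bzero R)]_(i <- s) (g i \oc f i) =
  \big[oplusm (badd R)/idm (bzero R)]_(i <- s) g i \oc
  \big[oplusm (badd R)/idm (bzero R)]_(i <- s) f i.
Proof.
move=> fg; elim: s => [|i s IHs].
  by rewrite !big_nil -[X in _ = X \oc _](congr1 _ (cod_idm (bzero R))) comp_idl.
rewrite !big_cons IHs [LHS]tmor_comp //.
have [_ ->] := hom_bigsum s f; have [-> _] := hom_bigsum s g.
exact: eq_bigr.
Qed.

End BigSum.

Section MatrixTensor.
Variables (R : bimonoidal) (n : nat).
Implicit Types (a b : 'M[ob R]_n) (f g : 'M[mor R]_n).

Lemma Mmor_hom f g : @hom (matcat R n)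
  (Mob (map_mx dom f) (map_mx dom g)) (Mob (map_mx cod f) (map_mx cod g))
  (Mmor f g).
Proof.
have fgkj i j k := tmor_hom (bmul R) (f i k) (g k j).
split; apply/matrixP => i j; rewrite !mxE.
- have [-> _] := hom_bigsum (index_enum 'I_n) (fun k => f i k <*m> g k j).
  by apply: eq_bigr => k _; rewrite !mxE; have [] := fgkj i j k.
- have [_ ->] := hom_bigsum (index_enum 'I_n) (fun k => f i k <*m> g k j).
  by apply: eq_bigr => k _; rewrite !mxE; have [] := fgkj i j k.
Qed.

Lemma Mmor_id a b :
  Mmor (map_mx (@idm R) a) (map_mx (@idm R) b) = map_mx (@idm R) (Mob a b).
Proof.
apply/matrixP => i j; rewrite !mxE.
rewrite (big_morph (@idm R) (fun u v => esym (tmor_id (badd R) u v)) erefl).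
by apply: eq_bigr => k _; rewrite !mxE; exact: tmor_id.
Qed.

Lemma Mmor_comp f f' g g' :
  map_mx cod f = map_mx dom f' -> map_mx cod g = map_mx dom g' ->
  Mmor (Mcomp f' f) (Mcomp g' g) = Mcomp (Mmor f' g') (Mmor f g).
Proof.
move=> /matrixP ff' /matrixP gg'; apply/matrixP => i j; rewrite !mxE.
have {}ff' u v : cod (f u v) = dom (f' u v) by have := ff' u v; rewrite !mxE.
have {}gg' u v : cod (g u v) = dom (g' u v) by have := gg' u v; rewrite !mxE.
rewrite -comp_bigsum => [|k].
  by apply: eq_bigr => k _; rewrite !mxE [LHS]tmor_comp.
have [_ ->] := tmor_hom (bmul R) (f i k) (g k j).
by have [-> _] := tmor_hom (bmul R) (f' i k) (g' k j); rewrite ff' gg'.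
Qed.

Definition mattensor : tensor_data (matcat R n) :=
  @TensorData (matcat R n) (@Mob R n) (@Mmor R n) (Mone R n) (@Massoc R n)
    Mmor_hom Mmor_id Mmor_comp.

(* Objects of GL_n(R): the class of A in the matrix ring over Gr(pi_0 R) has a
   two-sided inverse. *)
Definition GL (A : 'M[ob R]_n) : Prop :=
  let cA : 'M[gr (pi0 R)]_n := map_mx (fun x : ob R => gr_inj (pi0_class x)) A in
  exists B : 'M[gr (pi0 R)]_n, cA *m B = 1%:M /\ B *m cA = 1%:M.

End MatrixTensor.

Record dmap (p q : nat) := Dmap {
  dfun :> 'I_p.+1 -> 'I_q.+1;
  dfun_homo : forall i j : 'I_p.+1, (i <= j)%N -> (dfun i <= dfun j)%N }.

Lemma rev_dmap_homo p q (a : dmap p q) (i j : 'I_p.+1) : (i <= j)%N ->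
  (rev_ord (a (rev_ord i)) <= rev_ord (a (rev_ord j)))%N.
Proof.
by move=> ij /=; rewrite leq_sub2l // ltnS dfun_homo //= leq_sub2l.
Qed.

Definition rev_dmap p q (a : dmap p q) : dmap p q :=
  @Dmap p q (fun i => rev_ord (a (rev_ord i))) (rev_dmap_homo a).

(* Operators of simplicial objects are given by their graphs: [sc_ob a x y],
   [sc_mor a f g] and [ss_op a x y] mean that a^* x = y (or a^* f = g).  This is convenient because the elements of the objects at
   hand are families (indexed by the vertices) subject to conditions, on which
   a^* is precomposition with a. *)
Record simplicial_cat := SimplicialCat {
  sc_cat :> nat -> cat;
  sc_ob : forall p q, dmap p q -> ob (sc_cat q) -> ob (sc_cat p) -> Prop;
  sc_mor : forall p q, dmap p q -> mor (sc_cat q) -> mor (sc_cat p) -> Prop }.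

Definition simplicial_functor (X Y : simplicial_cat)
    (F : forall q, functor (X q) (Y q)) :=
  (forall p q (a : dmap p q) x y, sc_ob a x y -> sc_ob a (F q x) (F p y)) /\
  (forall p q (a : dmap p q) f g,
     sc_mor a f g -> sc_mor a (fmor (F q) f) (fmor (F p) g)).

Definition tilde (X : simplicial_cat) : simplicial_cat :=
  @SimplicialCat X (fun p q a => sc_ob (rev_dmap a))
    (fun p q a => sc_mor (rev_dmap a)).

Record simplicial_space := SimplicialSpace {
  ss_space :> nat -> topologicalType;
  ss_op : forall p q, dmap p q -> ss_space q -> ss_space p -> Prop }.

Section Realization.
Variable K : realType.

Definition simplex_set (q : nat) : set {ptws 'I_q.+1 -> K} :=
  [set t | (forall i, 0 <= t i) /\ \sum_i t i = 1]%classic.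

Definition simplex (q : nat) : topologicalType := set_type (@simplex_set q).

Definition mk_simplex q (t : 'I_q.+1 -> K) (tP : simplex_set t) : simplex q :=
  SigSub (mem_set tP).

Lemma push_subproof p q (a : dmap p q) (s : simplex p) :
  @simplex_set q (fun j => \sum_(i | a i == j) (set_val s : _ -> K) i).
Proof.
have [s0 s1] : simplex_set (set_val s : _ -> K) by exact: set_valP.
split=> [j|]; first by apply: sumr_ge0 => i _; exact: s0.
by rewrite -s1 [RHS](partition_big a xpredT).
Qed.

Definition push p q (a : dmap p q) (s : simplex p) : simplex q :=
  mk_simplex (push_subproof a s).

Lemma srev_subproof q (s : simplex q) :
  @simplex_set q (fun j => (set_val s : _ -> K) (rev_ord j)).
Proof.
have [s0 s1] : simplex_set (set_val s : _ -> K) by exact: set_valP.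
split=> [j|]; first exact: s0.
by rewrite -s1 [RHS](reindex_inj rev_ord_inj).
Qed.

Definition srev q (s : simplex q) : simplex q := mk_simplex (srev_subproof s).

Lemma point_subproof : @simplex_set 0 (fun=> 1).
Proof. by split=> [i|]; rewrite ?ler01 // big_ord1. Qed.

Definition point_simplex : simplex 0 := mk_simplex point_subproof.

Definition presentation (X : simplicial_space) :=
  {q : nat & (X q * simplex q)%type}.

Variant glue (X : simplicial_space) : presentation X -> presentation X -> Prop :=
  Glue p q (a : dmap p q) x y s : ss_op a x y ->
    glue (existT _ q (x, push a s)) (existT _ p (y, s)).

Definition realization (X : simplicial_space) : topologicalType :=
  quotient_topology {eq_quot (generated (@glue X))}.

Definition rpt (X : simplicial_space) q (x : X q) (s : simplex q) :
    realization X :=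
  \pi_({eq_quot (generated (@glue X))}) (existT _ q (x, s)).

Definition realizes (X Y : simplicial_space) (f : forall q, X q -> Y q)
    (F : realization X -> realization Y) :=
  continuous F /\ forall q (x : X q) s, F (rpt x s) = rpt (f q x) s.

(* An m-simplex of the nerve is a functor from the poset [m] to C; its values
   on pairs i >= j are normalized to identities. *)
Record chain (C : cat) (m : nat) := Chain {
  ch_ob : 'I_m.+1 -> ob C;
  ch_mor : 'I_m.+1 -> 'I_m.+1 -> mor C;
  ch_norm : forall i j : 'I_m.+1, ~~ (i < j)%N -> ch_mor i j = idm (ch_ob i);
  ch_hom : forall i j : 'I_m.+1, (i <= j)%N -> hom (ch_ob i) (ch_ob j) (ch_mor i j);
  ch_comp : forall i j k : 'I_m.+1, (i <= j <= k)%N ->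
    ch_mor i k = ch_mor j k \oc ch_mor i j }.

Definition nerve (C : cat) : simplicial_space :=
  @SimplicialSpace (fun m => discrete_topology {classic chain C m})
    (fun p q a (x : chain C q) (y : chain C p) =>
       (forall i, ch_ob y i = ch_ob x (a i)) /\
       (forall i j, ch_mor y i j = ch_mor x (a i) (a j))).

Section NerveMap.
Variables (C D : cat) (F : functor C D) (m : nat) (x : chain C m).

Lemma nerve_map_norm (i j : 'I_m.+1) : ~~ (i < j)%N ->
  fmor F (ch_mor x i j) = idm (F (ch_ob x i)).
Proof. by move=> ij; rewrite ch_norm // fmor_id. Qed.

Lemma nerve_map_hom (i j : 'I_m.+1) : (i <= j)%N ->
  hom (F (ch_ob x i)) (F (ch_ob x j)) (fmor F (ch_mor x i j)).
Proof. by move=> /(ch_hom x) [<- <-]; exact: fmor_hom. Qed.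

Lemma nerve_map_comp (i j k : 'I_m.+1) : (i <= j <= k)%N ->
  fmor F (ch_mor x i k) = fmor F (ch_mor x j k) \oc fmor F (ch_mor x i j).
Proof.
move=> /[dup] /(ch_comp x) -> /andP[/(ch_hom x)[_ ij] /(ch_hom x)[jk _]].
by rewrite fmor_comp // ij jk.
Qed.

Definition nerve_map : chain D m :=
  Chain nerve_map_norm nerve_map_hom nerve_map_comp.

End NerveMap.

(* A simplicial category is realized to the simplicial space of realizations
   of the nerves of its levels, which is in turn realized. *)
Definition level_realization (X : simplicial_cat) : simplicial_space :=
  @SimplicialSpace (fun q => realization (nerve (X q)))
    (fun p q a u v => exists m (x : chain (X q) m) (y : chain (X p) m) s,
       [/\ u = @rpt (nerve (X q)) m x s, v = @rpt (nerve (X p)) m y s,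
           forall i, sc_ob a (ch_ob x i) (ch_ob y i) &
           forall i j, sc_mor a (ch_mor x i j) (ch_mor y i j)]).

Definition cat_realization (X : simplicial_cat) : topologicalType :=
  realization (level_realization X).

Definition cat_rpt (X : simplicial_cat) q m (x : chain (X q) m)
    (s : simplex m) (t : simplex q) : cat_realization X :=
  @rpt (level_realization X) q (@rpt (nerve (X q)) m x s) t.

Definition cat_realizes (X Y : simplicial_cat)
    (f : forall q, functor (X q) (Y q))
    (F : cat_realization X -> cat_realization Y) :=
  continuous F /\ forall q m (x : chain (X q) m) s t,
    F (cat_rpt x s t) = cat_rpt (nerve_map (f q) x) s t.

(* G is the identification |X~| -> |X| reversing the coordinates *)
Definition reverses (X : simplicial_cat)
    (G : cat_realization (tilde X) -> cat_realization X) :=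
  continuous G /\ forall q m (x : chain (X q) m) s t,
    G (@cat_rpt (tilde X) q m x s t) = @cat_rpt X q m x s (srev t).

End Realization.

Section Bar.
Variables (C : cat) (T : tensor_data C) (P : ob C -> Prop) (q : nat).
Local Notation V := 'I_q.+1.

(* The objects of B_q of the full subcategory of C on the objects satisfying
   P.  Outside of the range i < j (resp. i < j < k) the data are normalized to
   the unit (resp. the identity), which implements the convention A^ii = 1. *)
Record bar_ob := BarOb {
  bA : V -> V -> ob C;
  bphi : V -> V -> V -> mor C;
  bA_sub : forall i j : V, (i < j)%N -> P (bA i j);
  bA_norm : forall i j : V, ~~ (i < j)%N -> bA i j = mone T;
  bphi_hom : forall i j k : V, (i < j < k)%N ->
    hom (mob T (bA i j) (bA j k)) (bA i k) (bphi i j k);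
  bphi_iso : forall i j k : V, (i < j < k)%N -> is_iso (bphi i j k);
  bphi_norm : forall i j k : V, ~~ (i < j < k)%N -> bphi i j k = idm (bA i k);
  bphi_coh : forall i j k l : V, [&& i < j, j < k & k < l]%N ->
    bphi i k l \oc mmor T (bphi i j k) (idm (bA k l)) =
    bphi i j l \oc (mmor T (idm (bA i j)) (bphi j k l)
                    \oc massoc T (bA i j) (bA j k) (bA k l)) }.

Record bar_mor := BarMor {
  bsrc : bar_ob;
  btgt : bar_ob;
  bf : V -> V -> mor C;
  bf_hom : forall i j, hom (bA bsrc i j) (bA btgt i j) (bf i j);
  bf_norm : forall i j : V, ~~ (i < j)%N -> bf i j = idm (mone T);
  bf_nat : forall i j k : V, (i < j < k)%N ->
    bf i k \oc bphi bsrc i j k =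
    bphi btgt i j k \oc mmor T (bf i j) (bf j k) }.

Lemma bar_mor_eq (f g : bar_mor) : bsrc f = bsrc g -> btgt f = btgt g ->
  (forall i j, bf f i j = bf g i j) -> f = g.
Proof.
case: f g => [x y f f1 f2 f3] [x' y' f' g1 g2 g3] /= xx' yy' ff'.
have {}ff' : f = f' by apply/funext => i; apply/funext => j.
by subst; congr BarMor; apply: Prop_irrelevance.
Qed.

Lemma bar_id_hom (x : bar_ob) i j :
  hom (bA x i j) (bA x i j) (idm (bA x i j)).
Proof. by split; rewrite ?dom_idm ?cod_idm. Qed.

Lemma bar_id_norm (x : bar_ob) (i j : V) : ~~ (i < j)%N ->
  idm (bA x i j) = idm (mone T).
Proof. by move=> /bA_norm ->. Qed.

Lemma bar_id_nat (x : bar_ob) (i j k : V) : (i < j < k)%N ->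
  idm (bA x i k) \oc bphi x i j k =
  bphi x i j k \oc mmor T (idm (bA x i j)) (idm (bA x j k)).
Proof.
by move=> /(bphi_hom x) [d c]; rewrite mmor_id -c comp_idl -d comp_idr.
Qed.

Definition bar_id (x : bar_ob) : bar_mor :=
  BarMor (@bar_id_hom x) (@bar_id_norm x) (@bar_id_nat x).

Section Comp.
Variables (g f : bar_mor) (fg : btgt f = bsrc g).

Let fgij i j : cod (bf f i j) = dom (bf g i j).
Proof. by have [_ ->] := bf_hom f i j; have [-> _] := bf_hom g i j; rewrite fg. Qed.

Lemma bar_comp_hom i j :
  hom (bA (bsrc f) i j) (bA (btgt g) i j) (bf g i j \oc bf f i j).
Proof.
split; first by rewrite dom_comp //; have [] := bf_hom f i j.
by rewrite cod_comp //; have [] := bf_hom g i j.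
Qed.

Lemma bar_comp_norm (i j : V) : ~~ (i < j)%N ->
  bf g i j \oc bf f i j = idm (mone T).
Proof.
move=> ij; rewrite (bf_norm f ij) (bf_norm g ij).
by rewrite -[X in X \oc _](congr1 _ (cod_idm (mone T))) comp_idl.
Qed.

Lemma bar_comp_nat (i j k : V) : (i < j < k)%N ->
  (bf g i k \oc bf f i k) \oc bphi (bsrc f) i j k =
  bphi (btgt g) i j k
    \oc mmor T (bf g i j \oc bf f i j) (bf g j k \oc bf f j k).
Proof.
move=> ijk; have [hf hg] := (bf_nat f ijk, bf_nat g ijk).
have [_ cs] := bphi_hom (bsrc f) ijk.
have [dm cm] := bphi_hom (btgt f) ijk.
have [dt _] := bphi_hom (btgt g) ijk.
have [dfm cfm] := mmor_hom T (bf f i j) (bf f j k).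
have [dgm cgm] := mmor_hom T (bf g i j) (bf g j k).
have [dfik cfik] := bf_hom f i k; have [dgik _] := bf_hom g i k.
have [[_ cfij] [_ cfjk]] := (bf_hom f i j, bf_hom f j k).
have [[_ cgij] [_ cgjk]] := (bf_hom g i j, bf_hom g j k).
rewrite -compA ?cs ?dfik ?fgij // hf compA.
- rewrite fg hg -compA ?mmor_comp ?fgij // ?cfm ?dgm ?fgij //.
  by rewrite cgm dt cgij cgjk.
- by rewrite cfm dm cfij cfjk.
- by rewrite cm dgik fg.
Qed.

Definition bar_comp_def : bar_mor :=
  BarMor bar_comp_hom bar_comp_norm bar_comp_nat.

End Comp.

Definition bar_comp (g f : bar_mor) : bar_mor :=
  if pselect (btgt f = bsrc g) is left fg then bar_comp_def fg else g.

Lemma bar_compE g f (fg : btgt f = bsrc g) : bar_comp g f = bar_comp_def fg.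
Proof.
rewrite /bar_comp; case: pselect => // fg'.
by rewrite (Prop_irrelevance fg fg').
Qed.

Lemma bar_dom_comp g f : btgt f = bsrc g -> bsrc (bar_comp g f) = bsrc f.
Proof. by move=> fg; rewrite (bar_compE fg). Qed.

Lemma bar_cod_comp g f : btgt f = bsrc g -> btgt (bar_comp g f) = btgt g.
Proof. by move=> fg; rewrite (bar_compE fg). Qed.

Lemma bar_comp_idl f : bar_comp (bar_id (btgt f)) f = f.
Proof.
rewrite (@bar_compE (bar_id _) f erefl); apply: bar_mor_eq => //= i j.
by have [_ <-] := bf_hom f i j; rewrite comp_idl.
Qed.

Lemma bar_comp_idr f : bar_comp f (bar_id (bsrc f)) = f.
Proof.
rewrite (@bar_compE f (bar_id _) erefl); apply: bar_mor_eq => //= i j.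
by have [<- _] := bf_hom f i j; rewrite comp_idr.
Qed.

Lemma bar_compA h g f : btgt f = bsrc g -> btgt g = bsrc h ->
  bar_comp h (bar_comp g f) = bar_comp (bar_comp h g) f.
Proof.
move=> fg gh; rewrite (bar_compE fg) (bar_compE gh).
rewrite (@bar_compE h (bar_comp_def fg) gh).
rewrite (@bar_compE (bar_comp_def gh) f fg).
apply: bar_mor_eq => //= i j.
have [_ cf] := bf_hom f i j; have [dg cg] := bf_hom g i j.
have [dh _] := bf_hom h i j.
by rewrite compA // ?cf ?dg ?cg ?dh ?fg ?gh.
Qed.

Definition bar_cat : cat := @Cat bar_ob bar_mor bsrc btgt bar_id bar_comp
  (fun=> erefl) (fun=> erefl) bar_dom_comp bar_cod_comp
  bar_comp_idl bar_comp_idr bar_compA.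

End Bar.

Definition bar (C : cat) (T : tensor_data C) (P : ob C -> Prop) :
    simplicial_cat :=
  @SimplicialCat (bar_cat T P)
    (fun p q a x y =>
       (forall i j, bA y i j = bA x (a i) (a j)) /\
       (forall i j k, bphi y i j k = bphi x (a i) (a j) (a k)))
    (fun p q a f g =>
       [/\ forall i j, bA (bsrc g) i j = bA (bsrc f) (a i) (a j),
           forall i j k, bphi (bsrc g) i j k = bphi (bsrc f) (a i) (a j) (a k),
           forall i j, bA (btgt g) i j = bA (btgt f) (a i) (a j),
           forall i j k, bphi (btgt g) i j k = bphi (btgt f) (a i) (a j) (a k) &
           forall i j, bf g i j = bf f (a i) (a j)]).

Section Kelley.
Variable T : topologicalType.
Local Open Scope classical_set_scope.

Definition kelley : Type := T.
HB.instance Definition _ := Choice.on kelley.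

Definition kelley_open (U : set kelley) : Prop :=
  forall (Z : topologicalType) (u : Z -> T),
    compact [set: Z] -> hausdorff_space Z -> continuous u ->
    open (u @^-1` U).

Lemma kelley_openT : kelley_open setT.
Proof. by move=> Z u _ _ _; rewrite preimage_setT; exact: openT. Qed.

Lemma kelley_openI : setI_closed kelley_open.
Proof.
move=> U V oU oV Z u cZ hZ cu; rewrite preimage_setI.
by apply: openI; [exact: oU|exact: oV].
Qed.

Lemma kelley_open_bigU (I : Type) (f : I -> set kelley) :
  (forall i, kelley_open (f i)) -> kelley_open (\bigcup_i f i).
Proof.
move=> of_ Z u cZ hZ cu; rewrite preimage_bigcup.
by apply: bigcup_open => i _; exact: of_.
Qed.

HB.instance Definition _ := @isOpenTopological.Build kelley kelley_open
  kelley_openT kelley_openI kelley_open_bigU.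

End Kelley.

Section UnitInterval.
Variable K : realType.
Local Open Scope classical_set_scope.

Definition unit_interval : Type := set_type (`[0, 1] : set K).
HB.instance Definition _ := Topological.on unit_interval.

Lemma zero_subproof : (`[0, 1] : set K) 0.
Proof. by rewrite /= in_itv /= lexx ler01. Qed.

Lemma one_subproof : (`[0, 1] : set K) 1.
Proof. by rewrite /= in_itv /= lexx ler01. Qed.

Definition itv_zero : unit_interval := SigSub (mem_set zero_subproof).
Definition itv_one : unit_interval := SigSub (mem_set one_subproof).

Lemma itv_zero_neq_one : itv_zero != itv_one.
Proof. by rewrite -val_eqE /= eq_sym oner_eq0. Qed.

HB.instance Definition _ := isBiPointed.Build unit_interval itv_zero_neq_one.

End UnitInterval.

Definition loop_space (K : realType) (X : topologicalType) (x : X) :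
    topologicalType :=
  {path (unit_interval K) from x to x}.

Definition loop_fun (K : realType) (X : topologicalType) (x : X)
    (g : loop_space K x) : unit_interval K -> X :=
  (g : {path (unit_interval K) from x to x}).

Section KTheory.
Variables (K : realType) (R : bimonoidal).

Definition BGL (n : nat) : simplicial_cat := bar (mattensor R n) (@GL R n).

Definition bsum_ob n m (A : 'M[ob R]_n) (B : 'M[ob R]_m) : 'M[ob R]_(n + m) :=
  block_mx A (const_mx (bzero R)) (const_mx (bzero R)) B.

Definition bsum_mor n m (f : 'M[mor R]_n) (g : 'M[mor R]_m) :
    'M[mor R]_(n + m) :=
  block_mx f (const_mx (idm (bzero R))) (const_mx (idm (bzero R))) g.

Definition is_block_sum n m q l (x : chain (BGL n q) l) (y : chain (BGL m q) l)
    (z : chain (BGL (n + m) q) l) : Prop :=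
  [/\ forall u i j, bA (ch_ob z u) i j =
        bsum_ob (bA (ch_ob x u) i j) (bA (ch_ob y u) i j),
      forall u i j k, bphi (ch_ob z u) i j k =
        bsum_mor (bphi (ch_ob x u) i j k) (bphi (ch_ob y u) i j k) &
      forall u v i j, bf (ch_mor z u v) i j =
        bsum_mor (bf (ch_mor x u v) i j) (bf (ch_mor y u v) i j)].

Definition GLmonoid : topologicalType :=
  {n : nat & cat_realization K (BGL n)}.

(* The multiplication is given by its graph: realization commutes with
   products, so any two points of |BGL_n| and |BGL_m| can be written with the
   same simplex coordinates, and their product is then the point having these
   coordinates in the block sum of the underlying simplices. *)
Definition GLmul (a b c : GLmonoid) : Prop :=
  exists n m q l (x : chain (BGL n q) l) (y : chain (BGL m q) l)
    (z : chain (BGL (n + m) q) l) (s : simplex K l) (t : simplex K q),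
    [/\ is_block_sum x y z,
        a = existT _ n (cat_rpt x s t), b = existT _ m (cat_rpt y s t) &
        c = existT _ (n + m)%N (cat_rpt z s t)].

Section Unit.
Local Notation T := (mattensor R 0).
Local Notation P := (@GL R 0).

Let none (i j : 'I_1) : (i < j)%N = false.
Proof. by rewrite !ord1. Qed.

Lemma bar_point_subproof1 (i j : 'I_1) : (i < j)%N -> P (mone T).
Proof. by rewrite none. Qed.
Lemma bar_point_subproof2 (i j k : 'I_1) : (i < j < k)%N ->
  hom (mob T (mone T) (mone T)) (mone T) (@idm (matcat R 0) (mone T)).
Proof. by rewrite none. Qed.
Lemma bar_point_subproof3 (i j k : 'I_1) : (i < j < k)%N ->
  is_iso (@idm (matcat R 0) (mone T)).
Proof. by rewrite none. Qed.
Lemma bar_point_subproof4 (i j k l : 'I_1) : [&& i < j, j < k & k < l]%N ->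
  idm (mone T) \oc mmor T (idm (mone T)) (idm (mone T)) =
  idm (mone T) \oc (mmor T (idm (mone T)) (idm (mone T))
                    \oc massoc T (mone T) (mone T) (mone T)).
Proof. by rewrite none. Qed.

Definition bar_point : ob (BGL 0 0) :=
  @BarOb (matcat R 0) T P 0 (fun _ _ => mone T) (fun _ _ _ => idm (mone T))
    bar_point_subproof1 (fun _ _ _ => erefl) bar_point_subproof2
    bar_point_subproof3 (fun _ _ _ _ => erefl) bar_point_subproof4.

Lemma chain_point_hom (i j : 'I_1) : (i <= j)%N ->
  hom bar_point bar_point (idm bar_point).
Proof. by split; rewrite ?dom_idm ?cod_idm. Qed.

Lemma chain_point_comp (i j k : 'I_1) : (i <= j <= k)%N ->
  idm bar_point = idm bar_point \oc idm bar_point.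
Proof. by rewrite -[X in X \oc _](congr1 _ (cod_idm bar_point)) comp_idl. Qed.

Definition chain_point : chain (BGL 0 0) 0 :=
  @Chain (BGL 0 0) 0 (fun=> bar_point) (fun _ _ => idm bar_point)
    (fun _ _ _ => erefl) chain_point_hom chain_point_comp.

End Unit.

Definition GLone : GLmonoid :=
  existT _ 0 (cat_rpt chain_point (point_simplex K) (point_simplex K)).

Inductive GLprod : seq GLmonoid -> GLmonoid -> Prop :=
| GLprod_nil : GLprod [::] GLone
| GLprod_cons a s b c : GLprod s b -> GLmul a b c -> GLprod (a :: s) c.

(* The powers of the monoid carry the product topology of compactly generated
   spaces.  The i-th component of a^* x is the product of the x_j for
   a(i) <= j < a(i+1). *)
Definition GLmonoid_bar : simplicial_space :=
  @SimplicialSpace (fun p => kelley {ptws 'I_p -> GLmonoid})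
    (fun p q a (x : 'I_q -> GLmonoid) (y : 'I_p -> GLmonoid) =>
       forall i : 'I_p, GLprod
         [seq x j | j <- [seq j : 'I_q <- enum 'I_q
            | (a (widen_ord (leqnSn p) i) <= j < a (lift ord0 i))%N]] (y i)).

Definition BGLmonoid : topologicalType := realization K GLmonoid_bar.

Definition BGLmonoid_point : BGLmonoid :=
  @rpt K GLmonoid_bar 0 (fun=> GLone) (point_simplex K).

Definition Ktheory : topologicalType := loop_space K BGLmonoid_point.

Variable Z : anti_involution R.

Definition zeta_t n (A : 'M[ob R]_n) : 'M[ob R]_n := (map_mx (zeta Z) A)^T.
Definition zetam_t n (f : 'M[mor R]_n) : 'M[mor R]_n :=
  (map_mx (fmor (zeta Z)) f)^T.

(* The inverse of mu : zeta(A . B)^t -> zeta(B)^t . zeta(A)^t *)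
Definition MmuV n (A B : 'M[ob R]_n) : 'M[mor R]_n :=
  \matrix_(i, j) \big[oplusm (badd R)/idm (bzero R)]_k muV Z (A j k) (B k i).

Definition is_tau n q (F : functor (BGL n q) (tilde (BGL n) q)) : Prop :=
  [/\ forall (x : ob (BGL n q)) i j,
        bA (F x) i j = zeta_t (bA x (rev_ord j) (rev_ord i)),
      forall (x : ob (BGL n q)) (i j k : 'I_q.+1), (i < j < k)%N ->
        bphi (F x) i j k =
        Mcomp (zetam_t (bphi x (rev_ord k) (rev_ord j) (rev_ord i)))
          (MmuV (bA x (rev_ord k) (rev_ord j)) (bA x (rev_ord j) (rev_ord i))) &
      forall (f : mor (BGL n q)) i j,
        bf (fmor F f) i j = zetam_t (bf f (rev_ord j) (rev_ord i))].

(* T is the self-map of K(R) obtained from the maps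
   |BGL_n| -> |tilde BGL_n| = |BGL_n| given by tau, by taking the disjoint
   union over n, then the bar construction, then loops. *)
Definition induced_by
    (tau : forall n q, functor (BGL n q) (tilde (BGL n) q))
    (T : Ktheory -> Ktheory) : Prop :=
  exists (t : forall n, cat_realization K (BGL n) ->
                        cat_realization K (tilde (BGL n)))
         (r : forall n, cat_realization K (tilde (BGL n)) ->
                        cat_realization K (BGL n))
         (b : BGLmonoid -> BGLmonoid),
    let m : GLmonoid -> GLmonoid :=
      fun u => existT _ (projT1 u) (r _ (t _ (projT2 u))) in
    [/\ forall n, cat_realizes (tau n) (t n), forall n, reverses (r n),
        @realizes K GLmonoid_bar GLmonoid_bar (fun p x i => m (x i)) b &
        forall (g : Ktheory) (s : unit_interval K),
          loop_fun (T g) s = b (loop_fun g s)].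

End KTheory.

(* Main.v *)
(* Conjugate transposition A |-> zeta(A)^t reverses matrix products up to the
   entrywise isomorphism mu.  That tau respects the cocycle condition of the bar
   construction amounts to mu being compatible with the associativity
   isomorphism of matrix multiplication; entrywise this follows from axioms (3)
   and (4), because the distributivity part of the associator of the source
   absorbs mu on sums, and the two rearrangements of double sums, one coming
   from each associator, are inverse to each other.  The identities zeta^2 = id
   and zeta(mu) mu = id give tau^2 = id.  Since mu is the identity when one
   argument is 0 or 1 (for 0 this is a consequence of distributivity), tau
   commutes with degeneracies and with block sums.  Hence |tau|, followed by the
   reversal of simplex coordinates, is an involution of the topological monoid
   of the |BGL_n|, and it induces one on the loops of its bar construction. *)

From HB Require Import structures.
From mathcomp Require Import all_boot all_order all_algebra.
From mathcomp Require Import all_classical all_reals.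
From mathcomp Require Import topology normedtype continuous_path.
Require Import Defs.

Set Implicit Arguments.
Unset Strict Implicit.
Unset Printing Implicit Defensive.

Import GRing.Theory.
Import numFieldNormedType.Exports.

Local Notation "a <+> b" := (oplus (badd _) a b)
  (at level 50, left associativity).
Local Notation "f <+m> g" := (oplusm (badd _) f g)
  (at level 50, left associativity).
Local Notation "a <*> b" := (otimes (bmul _) a b)
  (at level 40, left associativity).
Local Notation "f <*m> g" := (otimesm (bmul _) f g)
  (at level 40, left associativity).
Local Notation bzero R := (ozero (badd R)).
Local Notation bone R := (ounit (bmul R)).
Local Notation bsumm s f :=
  (\big[oplusm (badd _)/idm (bzero _)]_(j <- s) f j).

(** * Inverses and commuting squares in a category *)

Section Categories.
Variable C : cat.
Implicit Types (a b c : ob C) (f g h : mor C).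

Lemma comp_idl_eq a f : cod f = a -> idm a \oc f = f.
Proof. by move=> <-; exact: comp_idl. Qed.

Lemma comp_idr_eq a f : dom f = a -> f \oc idm a = f.
Proof. by move=> <-; exact: comp_idr. Qed.

Lemma comp_idm a : idm a \oc idm a = idm a.
Proof. by rewrite comp_idl_eq // cod_idm. Qed.

Lemma hom_idm a : hom a a (idm a).
Proof. by split; rewrite ?dom_idm ?cod_idm. Qed.

Lemma hom_comp a b c f g : hom a b f -> hom b c g -> hom a c (g \oc f).
Proof.
by move=> [fa fb] [gb gc]; split; rewrite ?dom_comp ?cod_comp // fb gb.
Qed.

Lemma inverse_of_sym f g : inverse_of f g -> inverse_of g f.
Proof. by move=> [[dg cg] gf fg]; split; rewrite ?dg ?cg. Qed.

Lemma inverse_of_comp f g f' g' : cod f = dom g ->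
  inverse_of f f' -> inverse_of g g' -> inverse_of (g \oc f) (f' \oc g').
Proof.
move=> fg [[df' cf'] ff' f'f] [[dg' cg'] gg' g'g].
split.
- rewrite dom_comp ?cod_comp //.
  by split; rewrite ?dom_comp ?cod_comp // ?cg' ?df'.
- rewrite dom_comp // -compA ?cod_comp ?cg' ?df' //.
  by rewrite (compA (h := g')) ?dg' // gg' -fg comp_idl.
- rewrite cod_comp // -compA ?dom_comp ?cod_comp ?cg' ?df' // ?cf' //.
  by rewrite (compA (h := f)) ?cg' ?cf' ?df' // f'f fg -cg' comp_idl.
Qed.

Lemma inverse_of_idm a : inverse_of (idm a) (idm a).
Proof. by split; rewrite ?dom_idm ?cod_idm ?comp_idm //; exact: hom_idm. Qed.

(** Compose the square with [g'] on one side and [f'] on the other. Naturality, distributivity and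
    associativity of [mu] are turned in this way into the corresponding laws for [muV]. *)
Lemma inverse_square f f' g g' u v : inverse_of f f' -> inverse_of g g' ->
  dom u = dom f -> cod u = dom g -> dom v = cod f -> cod v = cod g ->
  g \oc u = v \oc f -> u \oc f' = g' \oc v.
Proof.
move=> [[df' cf'] _ ff'] [[dg' cg'] gg' _] du cu dv cv e.
transitivity (g' \oc (g \oc u) \oc f').
  by rewrite compA ?gg' -?cu ?comp_idl.
rewrite e -!compA ?cod_comp ?dom_comp ?dv ?cv ?cf' ?dg' //.
by rewrite ff' -dv comp_idr.
Qed.

Lemma is_iso_comp f g :
  cod f = dom g -> is_iso f -> is_iso g -> is_iso (g \oc f).
Proof.
move=> fg [f' ff'] [g' gg'].
by exists (f' \oc g'); apply: inverse_of_comp.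
Qed.

Lemma fmor_inverse (D : cat) (F : functor C D) f g :
  inverse_of f g -> inverse_of (fmor F f) (fmor F g).
Proof.
move=> [[dg cg] gf fg]; have [dF cF] := fmor_hom F f.
have [dG cG] := fmor_hom F g.
split; first by split; rewrite ?dG ?cG ?dF ?cF ?dg ?cg.
- by rewrite -fmor_comp ?dg // gf fmor_id dF.
- by rewrite -fmor_comp ?cg // fg fmor_id cF.
Qed.

End Categories.

Section Typing.
Variable R : bimonoidal.
Implicit Types (a b c : ob R) (f g h : mor R).

Lemma dom_oplusm f g : dom (f <+m> g) = dom f <+> dom g.
Proof. by have [] := tmor_hom (badd R) f g. Qed.
Lemma cod_oplusm f g : cod (f <+m> g) = cod f <+> cod g.
Proof. by have [] := tmor_hom (badd R) f g. Qed.
Lemma dom_otimesm f g : dom (f <*m> g) = dom f <*> dom g.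
Proof. by have [] := tmor_hom (bmul R) f g. Qed.
Lemma cod_otimesm f g : cod (f <*m> g) = cod f <*> cod g.
Proof. by have [] := tmor_hom (bmul R) f g. Qed.
Lemma dom_psym a b : dom (psym (badd R) a b) = a <+> b.
Proof. by have [] := psym_hom (badd R) a b. Qed.
Lemma cod_psym a b : cod (psym (badd R) a b) = b <+> a.
Proof. by have [] := psym_hom (badd R) a b. Qed.
Lemma dom_dr a b c : dom (dr a b c) = a <*> b <+> a <*> c.
Proof. by have [] := dr_hom a b c. Qed.
Lemma cod_dr a b c : cod (dr a b c) = a <*> (b <+> c).
Proof. by have [] := dr_hom a b c. Qed.

Lemma dom_bsumm (I : Type) (s : seq I) (F : I -> mor R) :
  dom (bsumm s F) = bsum (fun i => dom (F i)) s.
Proof. by have [] := hom_bigsum s F. Qed.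
Lemma cod_bsumm (I : Type) (s : seq I) (F : I -> mor R) :
  cod (bsumm s F) = bsum (fun i => cod (F i)) s.
Proof. by have [] := hom_bigsum s F. Qed.

Lemma idm_oplus a b : idm a <+m> idm b = idm (a <+> b).
Proof. exact: tmor_id. Qed.
Lemma idm_otimes a b : idm a <*m> idm b = idm (a <*> b).
Proof. exact: tmor_id. Qed.

Lemma oplusm_comp f f' g g' : cod f = dom f' -> cod g = dom g' ->
  (f' \oc f) <+m> (g' \oc g) = (f' <+m> g') \oc (f <+m> g).
Proof. exact: tmor_comp. Qed.
Lemma otimesm_comp f f' g g' : cod f = dom f' -> cod g = dom g' ->
  (f' \oc f) <*m> (g' \oc g) = (f' <*m> g') \oc (f <*m> g).
Proof. exact: tmor_comp. Qed.

Lemma psym_oplusm f g : psym (badd R) (cod f) (cod g) \oc (f <+m> g) =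
  (g <+m> f) \oc psym (badd R) (dom f) (dom g).
Proof. exact: psym_nat. Qed.

Lemma oplusA : associative (oplus (badd R)). Proof. exact: tobA. Qed.
Lemma oplusmA : associative (oplusm (badd R)). Proof. exact: tmorA. Qed.
Lemma otimesA : associative (otimes (bmul R)). Proof. exact: tobA. Qed.
Lemma oplus0o : left_id (bzero R) (oplus (badd R)). Proof. exact: tob1l. Qed.
Lemma oplusm0o : left_id (idm (bzero R)) (oplusm (badd R)).
Proof. exact: tmor1l. Qed.
Lemma oplusmo0 : right_id (idm (bzero R)) (oplusm (badd R)).
Proof. exact: tmor1r. Qed.

Lemma bsum_nil (I : Type) (Y : I -> ob R) : bsum Y [::] = bzero R.
Proof. exact: big_nil. Qed.
Lemma bsum_cons (I : Type) (Y : I -> ob R) i s :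
  bsum Y (i :: s) = Y i <+> bsum Y s.
Proof. exact: big_cons. Qed.
Lemma eq_bsum (I : Type) (Y Y' : I -> ob R) s :
  Y =1 Y' -> bsum Y s = bsum Y' s.
Proof. by move=> YY'; apply: eq_bigr. Qed.
Lemma bsumm_idm (I : Type) (Y : I -> ob R) s :
  \big[oplusm (badd R)/idm (bzero R)]_(i <- s) idm (Y i) = idm (bsum Y s).
Proof.
by rewrite (big_morph (@idm R) (fun u v => esym (tmor_id (badd R) u v)) erefl).
Qed.

End Typing.

#[local] Hint Rewrite dom_idm cod_idm : typing.
(* Endpoints are compared after reassociating to the left and expanding left distributivity, both of
   which are strict equalities of objects. *)
#[local] Hint Rewrite dom_oplusm cod_oplusm dom_otimesm cod_otimesm dom_psym
  cod_psym dom_dr cod_dr dom_bsumm cod_bsumm bsum_cons bsum_nil oplusA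
  otimesA otimes_addl
  : typing.

(* Solves goals [dom f = a] and [cod f = a], discharging the composability
   conditions of [dom_comp] and [cod_comp] recursively. *)
Ltac typ := repeat first
  [ done
  | match goal with
    | H : dom _ = _ |- _ => progress rewrite !H
    | H : cod _ = _ |- _ => progress rewrite !H
    end
  | progress autorewrite with typing
  | rewrite dom_comp; last solve [typ]
  | rewrite cod_comp; last solve [typ]
  | solve [apply: eq_bsum => ?; typ]
  | solve [apply: (congr2 (oplus _)); typ]
  | solve [apply: (congr2 (otimes _)); typ] ].

Lemma inverse_of_oplusm (R : bimonoidal) (f f' g g' : mor R) :
  inverse_of f f' -> inverse_of g g' -> inverse_of (f <+m> g) (f' <+m> g').
Proof.
move=> [[df' cf'] ff' f'f] [[dg' cg'] gg' g'g]; split; first by split; typ.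
- by rewrite -oplusm_comp ?df' ?dg' // ff' gg' idm_oplus; typ.
- by rewrite -oplusm_comp ?cf' ?cg' // f'f g'g idm_oplus; typ.
Qed.

Lemma inverse_of_otimesm (R : bimonoidal) (f f' g g' : mor R) :
  inverse_of f f' -> inverse_of g g' -> inverse_of (f <*m> g) (f' <*m> g').
Proof.
move=> [[df' cf'] ff' f'f] [[dg' cg'] gg' g'g]; split; first by split; typ.
- by rewrite -otimesm_comp ?df' ?dg' // ff' gg' idm_otimes; typ.
- by rewrite -otimesm_comp ?cf' ?cg' // f'f g'g idm_otimes; typ.
Qed.

(** * Iterated sums and their exchange *)

Section Exchange.
Variable R : bimonoidal.

Section Interleave.
Variable J : Type.
Implicit Types (Y Z : J -> ob R) (s : seq J).

Lemma hom_interleave Y Z s : hom (bsum Y s <+> bsum Z s)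
  (bsum (fun j => Y j <+> Z j) s) (interleave Y Z s).
Proof.
elim: s => [|j s [ds cs]] /=; split; typ.
by rewrite oplus0o.
Qed.

Lemma dom_interleave Y Z s : dom (interleave Y Z s) = bsum Y s <+> bsum Z s.
Proof. by have [] := hom_interleave Y Z s. Qed.
Lemma cod_interleave Y Z s :
  cod (interleave Y Z s) = bsum (fun j => Y j <+> Z j) s.
Proof. by have [] := hom_interleave Y Z s. Qed.

End Interleave.

#[local] Hint Rewrite dom_interleave cod_interleave : typing.

Section ExchangeSum.
Variables I J : Type.
Implicit Types (X : I -> J -> ob R) (r : seq I) (s : seq J).

Lemma hom_exchange_sum X r s : hom (bsum (fun i => bsum (X i) s) r)
  (bsum (fun j => bsum (X^~ j) r) s) (exchange_sum X r s).
Proof.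
elim: r => [|i r [dr cr]] /=; split; typ.
  (* With no rows left, the target is a sum of zeros over [s], which collapses to zero. *)
  elim: s => [|j s IHs]; typ.
  by rewrite -IHs oplus0o.
Qed.

Lemma dom_exchange_sum X r s :
  dom (exchange_sum X r s) = bsum (fun i => bsum (X i) s) r.
Proof. by have [] := hom_exchange_sum X r s. Qed.
Lemma cod_exchange_sum X r s :
  cod (exchange_sum X r s) = bsum (fun j => bsum (X^~ j) r) s.
Proof. by have [] := hom_exchange_sum X r s. Qed.

End ExchangeSum.

#[local] Hint Rewrite dom_exchange_sum cod_exchange_sum : typing.

(** The symmetries and [f] act on disjoint summands, so bifunctoriality slides [f] out and
    [psym_inv] cancels the two symmetries. *)
Lemma psym_cancel (x b c : ob R) (f : mor R) :
  (idm x <+m> psym (badd R) b c <+m> idm (cod f)) \oc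
    ((idm (x <+> b) <+m> (idm c <+m> f)) \oc
     (idm x <+m> psym (badd R) c b <+m> idm (dom f))) =
  idm (x <+> c <+> b) <+m> f.
Proof.
rewrite oplusmA idm_oplus -oplusA -(idm_oplus x).
rewrite -!oplusm_comp; [|typ..].
rewrite !comp_idm comp_idr comp_idl.
by rewrite comp_idl_eq ?psym_inv ?idm_oplus ?oplusA; typ.
Qed.

(* Pushing an exchange of [s] against [k :: r] through [interleave] cancels the
   two symmetries, leaving the exchange of [s] against [r]. *)
Lemma exchange_sum_interleave (I J : Type) (X : I -> J -> ob R) k r s :
  exchange_sum (fun j i => X i j) s (k :: r) \oc
    interleave (X k) (fun j => bsum (X^~ j) r) s =
  idm (bsum (X k) s) <+m> exchange_sum (fun j i => X i j) s r.
Proof.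
elim: s => [|j s IHs] /=; first by rewrite comp_idm bsum_nil oplusm0o.

rewrite !bsum_cons -compA; [|typ..].
rewrite [X in _ \oc X]compA; [|typ..].
rewrite -(oplusm_comp (g' := exchange_sum _ _ _)); [|typ..].
rewrite IHs comp_idm -compA; [|typ..].
(* The flanking identities are presented as identities of the source and target of the smaller
   exchange, the form in which [psym_cancel] applies. *)
rewrite -(dom_exchange_sum (fun j => X^~ j)).
rewrite -(cod_exchange_sum (fun j => X^~ j)).
rewrite psym_cancel -(idm_oplus (_ <+> _)) -oplusmA -oplusm_comp; [|typ..].
by rewrite comp_idm.
Qed.

Lemma exchange_sum_nil (I J : Type) (X : I -> J -> ob R) r :
  exchange_sum X r [::] = idm (bzero R).
Proof.
elim: r => //= k r ->.
by rewrite bsum_nil oplusm0o comp_idm.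
Qed.

(** Induction on the rows: [exchange_sum_interleave] removes one row from both exchanges at once. No
    coherence theorem for symmetric monoidal categories is invoked. *)
Lemma exchange_sumK (I J : Type) (X : I -> J -> ob R) r s :
  exchange_sum (fun j i => X i j) s r \oc exchange_sum X r s =
  idm (bsum (fun i => bsum (X i) s) r).
Proof.
elim: r => [|k r IHr] /=; first by rewrite exchange_sum_nil comp_idm bsum_nil.
rewrite compA; [|typ..].
rewrite exchange_sum_interleave -oplusm_comp; [|typ..].
by rewrite comp_idm IHr idm_oplus bsum_cons.
Qed.

Lemma psym_middle_nat (f1 f2 g1 g2 : mor R) :
  (idm (cod f1) <+m> psym (badd R) (cod f2) (cod g1) <+m> idm (cod g2)) \oc
    ((f1 <+m> f2) <+m> (g1 <+m> g2)) =
  ((f1 <+m> g1) <+m> (f2 <+m> g2)) \oc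
    (idm (dom f1) <+m> psym (badd R) (dom f2) (dom g1) <+m> idm (dom g2)).
Proof.
rewrite !oplusmA -(oplusmA f1 f2) -(oplusmA f1 g1) -!oplusm_comp; [|typ..].
by rewrite psym_oplusm !comp_idl !comp_idr.
Qed.

Lemma interleave_nat (J : Type) (f g : J -> mor R) s :
  interleave (fun j => cod (f j)) (fun j => cod (g j)) s \oc
    (bsumm s f <+m> bsumm s g) =
  bsumm s (fun j => f j <+m> g j) \oc
    interleave (fun j => dom (f j)) (fun j => dom (g j)) s.
Proof.
elim: s => [|j s IHs] /=; first by rewrite !big_nil oplusm0o.
rewrite !big_cons -!cod_bsumm -compA; [|typ..].
rewrite psym_middle_nat !dom_bsumm compA; [|typ..].
rewrite -(oplusm_comp (f' := idm _)); [|typ..].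
rewrite IHs.
rewrite comp_idl_eq; [|typ..].
rewrite [in RHS]compA; [|typ..].
rewrite -[in RHS]oplusm_comp; [|typ..].
by rewrite comp_idr_eq; typ.
Qed.

Lemma exchange_sum_nat (I J : Type) (f : I -> J -> mor R) r s :
  exchange_sum (fun i j => cod (f i j)) r s \oc
    bsumm r (fun i => bsumm s (f i)) =
  bsumm s (fun j => bsumm r (f^~ j)) \oc
    exchange_sum (fun i j => dom (f i j)) r s.
Proof.
elim: r => [|k r IHr] /=.
  rewrite big_nil; under [in RHS]eq_bigr do rewrite big_nil.
  by rewrite bsumm_idm /bsum big1_eq.
rewrite big_cons -compA; [|typ..].
rewrite -oplusm_comp; [|typ..].
rewrite IHr comp_idl_eq; [|typ..].
under [in RHS]eq_bigr do rewrite big_cons.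
(* [interleave_nat] expects endpoints of sums of morphisms, whereas the exchange is indexed by sums
   of endpoints. *)
have codE g : (fun j : J => bsum (fun i => cod (f i j)) g) =
    (fun j => cod (bsumm g (f^~ j))) by apply/funext => j; rewrite cod_bsumm.
have domE g : (fun j : J => bsum (fun i => dom (f i j)) g) =
    (fun j => dom (bsumm g (f^~ j))) by apply/funext => j; rewrite dom_bsumm.
rewrite -[bsumm s (f k)](comp_idr_eq (dom_bsumm s (f k))).
rewrite oplusm_comp; [|typ..].
rewrite compA; [|typ..].
by rewrite codE domE interleave_nat -compA; typ.
Qed.

End Exchange.

#[local] Hint Rewrite dom_interleave cod_interleave dom_exchange_sum
  cod_exchange_sum : typing.

Section Distributivity.
Variables (R : bimonoidal) (J : Type).
Implicit Types (a : ob R) (Y : J -> ob R) (s : seq J).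

Lemma otimes_bsum Y s a : bsum Y s <*> a = bsum (fun j => Y j <*> a) s.
Proof.
elim: s => [|j s IHs]; first by rewrite !bsum_nil otimes0l.
by rewrite !bsum_cons otimes_addl IHs.
Qed.

Lemma otimesm_bsumm (f : J -> mor R) s g :
  bsumm s f <*m> g = \big[oplusm (badd R)/idm (bzero R)]_(j <- s) (f j <*m> g).
Proof.
elim: s => [|j s IHs]; first by rewrite !big_nil otimesm0l.
by rewrite !big_cons otimesm_addl IHs.
Qed.

Lemma hom_drsum a Y s :
  hom (bsum (fun j => a <*> Y j) s) (a <*> bsum Y s) (drsum a Y s).
Proof.
elim: s => [|j s [ds cs]] /=; split; typ.
by rewrite otimes0r.
Qed.

Lemma dom_drsum a Y s : dom (drsum a Y s) = bsum (fun j => a <*> Y j) s.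
Proof. by have [] := hom_drsum a Y s. Qed.
Lemma cod_drsum a Y s : cod (drsum a Y s) = a <*> bsum Y s.
Proof. by have [] := hom_drsum a Y s. Qed.

#[local] Hint Rewrite dom_drsum cod_drsum : typing.

Lemma drsum_nat (g : mor R) (f : J -> mor R) s :
  drsum (cod g) (fun j => cod (f j)) s \oc
    \big[oplusm (badd R)/idm (bzero R)]_(j <- s) (g <*m> f j) =
  (g <*m> bsumm s f) \oc drsum (dom g) (fun j => dom (f j)) s.
Proof.
elim: s => [|j s IHs] /=; first by rewrite !big_nil otimesm0r.
rewrite !big_cons -compA; [|typ..].
rewrite -oplusm_comp; [|typ..].
rewrite IHs comp_idl_eq; [|typ..].
rewrite -[_ <*m> f j](comp_idr_eq (dom_otimesm _ _)).
rewrite oplusm_comp; [|typ..].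
rewrite compA; [|typ..].
by rewrite -cod_bsumm dr_nat -compA; typ.
Qed.

End Distributivity.

#[local] Hint Rewrite dom_drsum cod_drsum : typing.

(** * The anti-involution and distributivity *)

Section AntiInvolution.
Variables (R : bimonoidal) (Z : anti_involution R).
Implicit Types (a b c : ob R) (f g : mor R).
Local Notation zeta := (zeta Z).
Local Notation zetam := (fmor zeta).
Local Notation mu := (mu Z).
Local Notation muV := (muV Z).

Lemma dom_zetam f : dom (zetam f) = zeta (dom f).
Proof. by have [] := fmor_hom zeta f. Qed.
Lemma cod_zetam f : cod (zetam f) = zeta (cod f).
Proof. by have [] := fmor_hom zeta f. Qed.
Lemma dom_mu a b : dom (mu a b) = zeta (a <*> b).
Proof. by have [] := mu_hom Z a b. Qed.
Lemma cod_mu a b : cod (mu a b) = zeta b <*> zeta a.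
Proof. by have [] := mu_hom Z a b. Qed.
Lemma dom_muV a b : dom (muV a b) = zeta b <*> zeta a.
Proof. by have [[-> _] _ _] := mu_muV Z a b; exact: cod_mu. Qed.
Lemma cod_muV a b : cod (muV a b) = zeta (a <*> b).
Proof. by have [[_ ->] _ _] := mu_muV Z a b; exact: dom_mu. Qed.

Lemma zeta_bsum (I : Type) (Y : I -> ob R) s :
  zeta (bsum Y s) = bsum (fun i => zeta (Y i)) s.
Proof. exact: (big_morph zeta (zeta_oplus Z) (zeta_zero Z)). Qed.

Lemma zetam_idm0 : zetam (idm (bzero R)) = idm (bzero R).
Proof. by rewrite fmor_id zeta_zero. Qed.

Lemma zetam_bsumm (I : Type) (f : I -> mor R) s : zetam (bsumm s f) =
  \big[oplusm (badd R)/idm (bzero R)]_(i <- s) zetam (f i).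
Proof. exact: (big_morph zetam (zeta_oplusm Z) zetam_idm0). Qed.

#[local] Hint Rewrite dom_zetam cod_zetam dom_mu cod_mu dom_muV cod_muV
  (zeta_oplus Z) zeta_bsum (zeta_ob_inv Z) (zeta_zero Z) : typing.

Lemma zetam_interleave (I : Type) (X Y : I -> ob R) s :
  zetam (interleave X Y s) =
  interleave (fun i => zeta (X i)) (fun i => zeta (Y i)) s.
Proof.
elim: s => [|i s IHs] /=; first exact: zetam_idm0.
rewrite fmor_comp; [|typ..].
by rewrite !zeta_oplusm !fmor_id zeta_sym zeta_oplus !zeta_bsum IHs.
Qed.

Lemma zetam_exchange_sum (I J : Type) (X : I -> J -> ob R) r s :
  zetam (exchange_sum X r s) = exchange_sum (fun i j => zeta (X i j)) r s.
Proof.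
elim: r => [|k r IHr] /=; first exact: zetam_idm0.
rewrite fmor_comp; [|typ..].
rewrite zetam_interleave zeta_oplusm fmor_id zeta_bsum IHr.
by congr (interleave _ _ _ \oc _); apply/funext => j; rewrite zeta_bsum.
Qed.

Lemma muV_nat f g : zetam (f <*m> g) \oc muV (dom f) (dom g) =
  muV (cod f) (cod g) \oc (zetam g <*m> zetam f).
Proof.
by apply: (inverse_square (mu_muV Z _ _) (mu_muV Z _ _)) (mu_nat Z f g); typ.
Qed.

Lemma muV_dr a b c : zetam (dr a b c) \oc (muV a b <+m> muV a c) =
  muV a (b <+> c).
Proof.
have inv := inverse_of_oplusm (mu_muV Z a b) (mu_muV Z a c).
(* The axiom [mu_dr] is a triangle; an identity as fourth side makes it a square that can be
   inverted. The same device serves for [muV_dl] and [muVA]. *)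
rewrite (inverse_square (v := idm (zeta (b <+> c) <*> zeta a))
  inv (mu_muV Z a (b <+> c))); typ.
- by rewrite comp_idr_eq; typ.
- by rewrite mu_dr comp_idl_eq; typ.
Qed.

Lemma muV_dl a b c : muV (a <+> b) c \oc dr (zeta c) (zeta a) (zeta b) =
  muV a c <+m> muV b c.
Proof.
have inv := inverse_of_oplusm (mu_muV Z a c) (mu_muV Z b c).
rewrite -(inverse_square (u := idm (zeta ((a <+> b) <*> c)))
  inv (mu_muV Z (a <+> b) c)); typ.
- by rewrite comp_idl_eq; typ.
- by rewrite comp_idr_eq ?mu_dl; typ.
Qed.

Lemma muVA a b c : muV a (b <*> c) \oc (muV b c <*m> idm (zeta a)) =
  muV (a <*> b) c \oc (idm (zeta c) <*m> muV a b).
Proof.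
have inv := inverse_of_comp _ (mu_muV Z a (b <*> c))
  (inverse_of_otimesm (mu_muV Z b c) (inverse_of_idm (zeta a))).
have inv' := inverse_of_comp _ (mu_muV Z (a <*> b) c)
  (inverse_of_otimesm (inverse_of_idm (zeta c)) (mu_muV Z a b)).
rewrite -[LHS](@comp_idl_eq _ (zeta (a <*> b <*> c))); [|typ..].
rewrite -[RHS](@comp_idr_eq _ (zeta c <*> zeta b <*> zeta a)); [|typ..].
apply: (inverse_square (inv _) (inv' _)); typ.
by rewrite comp_idr_eq ?comp_idl_eq ?muA; typ.
Qed.

Lemma muV1l a : muV (bone R) a = idm (zeta a).
Proof.
have [_ + _] := mu_muV Z (bone R) a.
by rewrite mu1l dom_idm comp_idr_eq ?dom_muV ?zeta_one ?tob1r // /otimes tob1r.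
Qed.

Lemma muV1r a : muV a (bone R) = idm (zeta a).
Proof.
have [_ + _] := mu_muV Z a (bone R).
by rewrite mu1r dom_idm comp_idr_eq ?dom_muV ?zeta_one // /otimes tob1l.
Qed.

(* The axiom [dr_dl] at c = 0, where tensoring with [idm c] is constant. *)
Lemma dr00 a : dr a (bzero R) (bzero R) = idm (bzero R).
Proof.
have := dr_dl a (bzero R) (bzero R) (bzero R).
by rewrite otimesm0r !otimes0l => <-.
Qed.

(** The Eckmann-Hilton argument: the sum factors as [(f <+m> id) \oc (id <+m> f)], and zero is a
    strict unit. *)
Lemma oplusm_end0 f : hom (bzero R) (bzero R) f -> f <+m> f = f \oc f.
Proof.
move=> [d c].
rewrite -[X in X <+m> _](comp_idr_eq d) -[X in _ <+m> X](comp_idl_eq c).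
by rewrite oplusm_comp ?oplusm0o ?oplusmo0; typ.
Qed.

Lemma idempotent_iso f g : inverse_of f g -> dom f = cod f -> f \oc f = f ->
  f = idm (dom f).
Proof.
move=> [[dg cg] gf fg] dc ff.
by rewrite -[LHS]comp_idl -dc -gf -compA ?dg // -?dc // ff.
Qed.

(* At 0, sums of endomorphisms are composites, so [muV_dl] makes the isomorphism
   [muV 0 a] idempotent. *)
Lemma muV0l a : muV (bzero R) a = idm (bzero R).
Proof.
have [d c] : hom (bzero R) (bzero R) (muV (bzero R) a).
  by split; rewrite ?dom_muV ?cod_muV ?otimes0l zeta_zero // otimes0r.
rewrite -[RHS](congr1 _ d).
apply: (idempotent_iso (inverse_of_sym (mu_muV Z _ _))); first by rewrite d c.
rewrite -oplusm_end0 // -muV_dl zeta_zero dr00 comp_idr_eq.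
all: by rewrite oplus0o.
Qed.

(** As for [muV0l], with idempotence now supplied by [muV_dr]. *)
Lemma muV0r a : muV a (bzero R) = idm (bzero R).
Proof.
have [d c] : hom (bzero R) (bzero R) (muV a (bzero R)).
  by split; rewrite ?dom_muV ?cod_muV ?otimes0r zeta_zero // otimes0l.
rewrite -[RHS](congr1 _ d).
apply: (idempotent_iso (inverse_of_sym (mu_muV Z _ _))); first by rewrite d c.
rewrite -oplusm_end0 // -[in RHS](oplus0o (bzero R)) -muV_dr dr00 zetam_idm0.
by rewrite comp_idl_eq // cod_oplusm c oplus0o.
Qed.

(** The two factors are inverse to those of the composite in [mu_inv], which is an identity. This is
    what makes tau square to the identity on the structure isomorphisms. *)
Lemma muV_zeta a b : zetam (muV a b) \oc muV (zeta b) (zeta a) = idm (a <*> b).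
Proof.
have [_ e _] := fmor_inverse zeta (mu_muV Z a b).
have [_ e' _] := mu_muV Z (zeta b) (zeta a).
rewrite -[LHS](@comp_idr_eq _ (a <*> b)); [|typ..].
rewrite -(mu_inv Z) compA; [|typ..].
rewrite -[_ \oc mu _ _]compA; [|typ..].
rewrite e' comp_idr_eq; [|typ..].
by rewrite e mu_inv; typ.
Qed.

(** [muV0r] handles the empty sum and [muV_dr] each further summand. *)
Lemma muV_bsum_r (J : Type) a (Y : J -> ob R) s :
  zetam (drsum a Y s) \oc
    \big[oplusm (badd R)/idm (bzero R)]_(j <- s) muV a (Y j) =
  muV a (bsum Y s).
Proof.
elim: s => [|j s IHs] /=.
  by rewrite big_nil zetam_idm0 comp_idm bsum_nil muV0r.
rewrite big_cons fmor_comp; [|typ..].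
rewrite zeta_oplusm fmor_id -compA; [|typ..].
rewrite -oplusm_comp; [|typ..].
by rewrite IHs comp_idl_eq ?muV_dr ?bsum_cons; typ.
Qed.

(** Here zeta turns the identity d_l of the source into a right distributivity of the target, so
    [drsum] occurs without zeta and is applied before [muV]. *)
Lemma muV_bsum_l (J : Type) (Y : J -> ob R) s c :
  muV (bsum Y s) c \oc drsum (zeta c) (fun j => zeta (Y j)) s =
  \big[oplusm (badd R)/idm (bzero R)]_(j <- s) muV (Y j) c.
Proof.
elim: s => [|j s IHs] /=; first by rewrite big_nil bsum_nil muV0l comp_idm.
rewrite big_cons bsum_cons -zeta_bsum compA; [|typ..].
rewrite muV_dl -oplusm_comp; [|typ..].
by rewrite IHs comp_idr_eq; typ.
Qed.

End AntiInvolution.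

#[local] Hint Rewrite dom_zetam cod_zetam dom_mu cod_mu dom_muV cod_muV
  zeta_oplus zeta_bsum zeta_ob_inv zeta_zero : typing.

(** * Reversal of triple products and the associator *)

Section AssociativitySum.
Variables (R : bimonoidal) (Z : anti_involution R) (J I : Type).
Variables (a : J -> ob R) (b : J -> I -> ob R) (c : I -> ob R).
Variables (s : seq J) (r : seq I).
Local Notation zeta := (zeta Z).
Local Notation zetam := (fmor zeta).
Local Notation muV := (muV Z).

(** The reversal isomorphism of a triple product; its two bracketings agree by [muVA], which is
    [nuE]. *)
Let nu j k :=
  muV (a j <*> b j k) (c k) \oc (idm (zeta (c k)) <*m> muV (a j) (b j k)).

Let nuE j k : nu j k =
  muV (a j) (b j k <*> c k) \oc (muV (b j k) (c k) <*m> idm (zeta (a j))).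
Proof. by rewrite muVA. Qed.

Let dom_nu j k : dom (nu j k) = zeta (c k) <*> zeta (b j k) <*> zeta (a j).
Proof. rewrite /nu; typ. Qed.
Let cod_nu j k : cod (nu j k) = zeta (a j <*> b j k <*> c k).
Proof. rewrite /nu; typ. Qed.

(** Naturality moves [drsum] past the inner [muV], and [muV_bsum_l] then absorbs it. *)
Let nu_l k :
  muV (bsum (fun j => a j <*> b j k) s) (c k) \oc
    (idm (zeta (c k)) <*m> bsumm s (fun j => muV (a j) (b j k))) \oc
    drsum (zeta (c k)) (fun j => zeta (b j k) <*> zeta (a j)) s =
  bsumm s (nu^~ k).
Proof.
rewrite -compA; [|typ..].
have := drsum_nat (idm (zeta (c k))) (fun j => muV (a j) (b j k)) s.
rewrite dom_idm cod_idm.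
under [X in drsum _ X]funext do rewrite cod_muV.
under [X in _ = _ \oc drsum _ X _]funext do rewrite dom_muV.
move=> <-; rewrite compA; [|typ..].
rewrite muV_bsum_l -comp_bigsum // => j; typ.
Qed.

(** With [nu] in its other bracketing, [muV_bsum_r] absorbs the distributivity; the remaining factor
    is collected by strict left distributivity. *)
Let nu_r j :
  zetam (drsum (a j) (fun k => b j k <*> c k) r) \oc bsumm r (nu j) =
  muV (a j) (bsum (fun k => b j k <*> c k) r) \oc
    (bsumm r (fun k => muV (b j k) (c k)) <*m> idm (zeta (a j))).
Proof.
under eq_bigr do rewrite nuE.
rewrite comp_bigsum; last by move=> k; typ.
rewrite compA; [|typ..].
by rewrite muV_bsum_r otimesm_bsumm.
Qed.

(** A single entry of [MmuV_assoc]. Once [nu_l] and [nu_r] have absorbed the distributivity parts of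
    both associators, only a double sum of [nu] between two exchanges is left. *)
Lemma muV_assoc_sum :
  bsumm s (fun j => muV (a j) (bsum (fun k => b j k <*> c k) r)) \oc
    bsumm s (fun j =>
      bsumm r (fun k => muV (b j k) (c k)) <*m> idm (zeta (a j))) =
  zetam (bsumm s (fun j => drsum (a j) (fun k => b j k <*> c k) r) \oc
    exchange_sum (fun k j => a j <*> b j k <*> c k) r s) \oc
  (bsumm r (fun k => muV (bsum (fun j => a j <*> b j k) s) (c k)) \oc
   bsumm r (fun k =>
     idm (zeta (c k)) <*m> bsumm s (fun j => muV (a j) (b j k))) \oc
   (bsumm r (fun k =>
      drsum (zeta (c k)) (fun j => zeta (b j k) <*> zeta (a j)) s) \oc
    exchange_sum (fun j k => zeta (c k) <*> zeta (b j k) <*> zeta (a j)) s r)).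
Proof.
rewrite fmor_comp; [|typ..].
rewrite zetam_bsumm zetam_exchange_sum.
rewrite [X in _ = _ \oc X]compA; [|typ..].
transitivity (bsumm s (fun j => zetam (drsum (a j) (fun k => b j k <*> c k) r)
    \oc bsumm r (nu j))).
  rewrite -comp_bigsum => [|j]; last by typ.
  by apply: eq_bigr => j _; rewrite nu_r.
have -> : bsumm r (fun k => muV (bsum (fun j => a j <*> b j k) s) (c k)) \oc
      bsumm r (fun k =>
        idm (zeta (c k)) <*m> bsumm s (fun j => muV (a j) (b j k))) \oc
    bsumm r (fun k =>
      drsum (zeta (c k)) (fun j => zeta (b j k) <*> zeta (a j)) s) =
    bsumm r (fun k => bsumm s (nu^~ k)).
  rewrite -!comp_bigsum; [|by move=> k; typ..].
  by apply: eq_bigr => k _; rewrite nu_l.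
have codE : (fun k j => zeta (a j <*> b j k <*> c k)) =
    (fun k j => cod (nu j k)) by do 2!apply/funext => ?; rewrite cod_nu.
have domE : (fun j k => zeta (c k) <*> zeta (b j k) <*> zeta (a j)) =
    (fun j k => dom (nu j k)) by do 2!apply/funext => ?; rewrite dom_nu.
(* Naturality carries one exchange across the double sum of [nu], next to the opposite exchange, and
   [exchange_sumK] cancels the pair. *)
rewrite codE domE -(exchange_sum_nat (fun j k => nu j k)).
rewrite -compA; [|typ..].
rewrite [X in _ \oc X]compA; [|typ..].
rewrite (exchange_sumK (fun j k => cod (nu j k))) comp_idl_eq; [|typ..].
by rewrite comp_bigsum // => j; typ.
Qed.

End AssociativitySum.

(** * Conjugate transposition of matrices *)

Section MatrixZeta.
Variables (R : bimonoidal) (Z : anti_involution R).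

Lemma zeta_tE n (A : 'M[ob R]_n) i j : zeta_t Z A i j = zeta Z (A j i).
Proof. by rewrite !mxE. Qed.
Lemma zetam_tE n (f : 'M[mor R]_n) i j :
  zetam_t Z f i j = fmor (zeta Z) (f j i).
Proof. by rewrite !mxE. Qed.
Lemma MobE n (A B : 'M[ob R]_n) i j :
  Mob A B i j = bsum (fun k => A i k <*> B k j) (index_enum 'I_n).
Proof. by rewrite !mxE. Qed.
Lemma MmorE n (f g : 'M[mor R]_n) i j :
  Mmor f g i j = bsumm (index_enum 'I_n) (fun k => f i k <*m> g k j).
Proof. by rewrite !mxE. Qed.
Lemma MmuVE n (A B : 'M[ob R]_n) i j :
  MmuV Z A B i j = bsumm (index_enum 'I_n) (fun k => muV Z (A j k) (B k i)).
Proof. by rewrite !mxE. Qed.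

Lemma zeta_tK n : involutive (@zeta_t R Z n).
Proof. by move=> A; apply/matrixP => i j; rewrite !zeta_tE zeta_ob_inv. Qed.
Lemma zetam_tK n : involutive (@zetam_t R Z n).
Proof. by move=> f; apply/matrixP => i j; rewrite !zetam_tE zeta_mor_inv. Qed.

Lemma zeta_t_one n : zeta_t Z (Mone R n) = Mone R n.
Proof.
apply/matrixP => i j; rewrite zeta_tE !mxE eq_sym.
by case: eqP => _; rewrite ?zeta_one ?zeta_zero.
Qed.

Lemma zetam_t_idm n (A : 'M[ob R]_n) :
  zetam_t Z (@idm (matcat R n) A) = @idm (matcat R n) (zeta_t Z A).
Proof. by apply/matrixP => i j; rewrite zetam_tE !mxE fmor_id. Qed.

Section Size.
Variable n : nat.
Implicit Types (A B C : ob (matcat R n)) (f g : mor (matcat R n)).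
Local Notation zeta_t := (zeta_t Z).
Local Notation zetam_t := (zetam_t Z).
Local Notation MmuV := (MmuV Z).
Local Notation Mid := (@idm (matcat R n)).

Lemma zetam_t_dom f : dom (zetam_t f : mor (matcat R n)) = zeta_t (dom f).
Proof. by apply/matrixP => i j; rewrite !mxE dom_zetam. Qed.
Lemma zetam_t_cod f : cod (zetam_t f : mor (matcat R n)) = zeta_t (cod f).
Proof. by apply/matrixP => i j; rewrite !mxE cod_zetam. Qed.

Lemma zetam_t_comp g f : cod f = dom g ->
  zetam_t (g \oc f) = (zetam_t g : mor (matcat R n)) \oc zetam_t f.
Proof.
move=> /matrixP fg; apply/matrixP => i j; rewrite !mxE fmor_comp //.
by have := fg j i; rewrite !mxE.
Qed.

Lemma MmuV_dom A B :
  dom (MmuV A B : mor (matcat R n)) = Mob (zeta_t B) (zeta_t A).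
Proof.
apply/matrixP => i j; rewrite mxE MmuVE MobE; typ.
by apply: eq_bsum => k; rewrite !zeta_tE; typ.
Qed.
Lemma MmuV_cod A B :
  cod (MmuV A B : mor (matcat R n)) = zeta_t (Mob A B).
Proof.
apply/matrixP => i j; rewrite mxE MmuVE zeta_tE MobE; typ.
Qed.

Lemma Mmor_dom f g : dom (Mmor f g : mor (matcat R n)) = Mob (dom f) (dom g).
Proof. by have [] := Mmor_hom f g. Qed.
Lemma Mmor_cod f g : cod (Mmor f g : mor (matcat R n)) = Mob (cod f) (cod g).
Proof. by have [] := Mmor_hom f g. Qed.

Lemma MmuV_iso A B : @is_iso (matcat R n) (MmuV A B).
Proof.
exists (\matrix_(i, j)
  bsumm (index_enum 'I_n) (fun k => mu Z (A j k) (B k i)))%R.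
have inv i j : inverse_of (MmuV A B i j)
    (bsumm (index_enum 'I_n) (fun k => mu Z (A j k) (B k i))).
  rewrite MmuVE; elim/big_rec2: _ => [|k f g _ fg].
    exact: inverse_of_idm.
  apply: inverse_of_oplusm => //.
  exact/inverse_of_sym/mu_muV.
split; first split; apply/matrixP => i j; have [[d c] l r] := inv i j.
- by rewrite !mxE d MmuVE.
- by rewrite !mxE c MmuVE.
- by rewrite !mxE -MmuVE -l !mxE.
- by rewrite !mxE -MmuVE -r !mxE.
Qed.

Lemma MmuV_nat f g :
  (zetam_t (Mmor f g) : mor (matcat R n)) \oc MmuV (dom f) (dom g) =
  (MmuV (cod f) (cod g) : mor (matcat R n)) \oc
    Mmor (zetam_t g) (zetam_t f).
Proof.
apply/matrixP => i j.
rewrite [LHS]mxE [RHS]mxE zetam_tE !MmorE !MmuVE zetam_bsumm.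
rewrite -!comp_bigsum; [|by move=> k; rewrite ?zetam_tE !mxE; typ..].
by apply: eq_bigr => k _; rewrite !zetam_tE !mxE muV_nat.
Qed.

Lemma MmuV_assoc A B C :
  (MmuV A (Mob B C) : mor (matcat R n)) \oc Mmor (MmuV B C) (Mid (zeta_t A)) =
  (zetam_t (Massoc A B C) : mor (matcat R n)) \oc
   ((MmuV (Mob A B) C : mor (matcat R n)) \oc
     Mmor (Mid (zeta_t C)) (MmuV A B) \oc
     Massoc (zeta_t C) (zeta_t B) (zeta_t A)).
Proof.
apply/matrixP => i l; rewrite [LHS]mxE [RHS]mxE.
have MassocE (A' B' C' : 'M[ob R]_n) p q : Massoc A' B' C' p q =
    bsumm (index_enum 'I_n) (fun j => drsum (A' p j)
      (fun k => B' j k <*> C' k q) (index_enum 'I_n)) \oc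
    exchange_sum (fun k j => A' p j <*> B' j k <*> C' k q)
      (index_enum 'I_n) (index_enum 'I_n) by rewrite mxE.
(* Matrices are rewritten as functions of both indices, so that the rewriting reaches entries under
   summation binders. *)
have zE (A' : 'M[ob R]_n) : fun_of_matrix (zeta_t A') =
    fun p q => zeta Z (A' q p).
  by do 2!apply/funext => ?; rewrite zeta_tE.
have ME (A' B' : 'M[ob R]_n) : fun_of_matrix (Mob A' B') =
    fun p q => bsum (fun k => A' p k <*> B' k q) (index_enum 'I_n).
  by do 2!apply/funext => ?; rewrite MobE.
have MVE (A' B' : 'M[ob R]_n) : fun_of_matrix (MmuV A' B') =
    fun p q => bsumm (index_enum 'I_n) (fun k => muV Z (A' q k) (B' k p)).
  by do 2!apply/funext => ?; rewrite MmuVE.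
have IE (A' : 'M[ob R]_n) : fun_of_matrix (Mid A') = fun p q => idm (A' p q).
  by do 2!apply/funext => ?; rewrite mxE.
rewrite [X in _ = _ \oc X]mxE [X in _ = _ \oc (X \oc _)]mxE.
rewrite zetam_tE !MassocE !MmorE.
rewrite !MVE !ME !IE !zE.
(* Because of the transposition, the entry (i, l) involves row [l] of [A] and column [i] of [C]. *)
exact: (muV_assoc_sum Z (A l) B (C^~ i)).
Qed.

(** Only one summand survives: it is an identity by [muV1l], and the others are identities of zero
    by [muV0l]. *)
Lemma MmuV_1l A : MmuV (Mone R n) A = Mid (zeta_t A).
Proof.
apply/matrixP => i j; rewrite MmuVE mxE zeta_tE (big_only1 j) // => [|k kj _].
  by rewrite mxE eqxx muV1l.
by rewrite mxE eq_sym (negPf kj) muV0l.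
Qed.

Lemma MmuV_1r A : MmuV A (Mone R n) = Mid (zeta_t A).
Proof.
apply/matrixP => i j; rewrite MmuVE mxE zeta_tE (big_only1 i) // => [|k ki _].
  by rewrite mxE eqxx muV1r.
by rewrite mxE (negPf ki) muV0r.
Qed.

Lemma MmuV_zeta A B : (zetam_t (MmuV A B) : mor (matcat R n)) \oc
  MmuV (zeta_t B) (zeta_t A) = Mid (Mob A B).
Proof.
apply/matrixP => i j; rewrite [LHS]mxE [RHS]mxE.
rewrite zetam_tE !MmuVE MobE zetam_bsumm.
rewrite -comp_bigsum => [|k]; last by rewrite !zeta_tE; typ.
rewrite -bsumm_idm; apply: eq_bigr => k _.
by rewrite !zeta_tE muV_zeta.
Qed.

End Size.

End MatrixZeta.

(** * Conjugate transposition and invertibility over the group completion *)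

Section GroupCompletionMap.
Variables (S : pzSemiRingType) (z : S -> S).
Hypotheses (z0 : z 0%R = 0%R) (z1 : z 1%R = 1%R).
Hypotheses (zD : {morph z : x y / (x + y)%R}).
Hypotheses (zM : {morph z : x y / (x * y)%R >-> (y * x)%R}).
Local Open Scope ring_scope.
(** * Realizations and loops *)

Local Open Scope quotient_scope.

Definition gr_anti (u : gr S) : gr S := \pi_(gr S) (z (repr u).1, z (repr u).2).

Lemma gr_antiE (x : S * S) :
  gr_anti (\pi_(gr S) x) = \pi_(gr S) (z x.1, z x.2).
Proof.
apply/eqP/grP => /=; have [k e] := repr_gr x.
by exists (z k); rewrite -!zD e.
Qed.

Lemma gr_anti_inj x : gr_anti (gr_inj x) = gr_inj (z x).
Proof. by rewrite /gr_inj gr_antiE /= z0. Qed.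

Lemma gr_antiD : {morph gr_anti : u v / u + v}.
Proof.
elim/gr_ind=> x; elim/gr_ind=> y.
by rewrite [X in gr_anti X]gr_addE !gr_antiE [RHS]gr_addE /= !zD.
Qed.

Lemma gr_antiM : {morph gr_anti : u v / u * v >-> v * u}.
Proof.
elim/gr_ind=> x; elim/gr_ind=> y.
rewrite [X in gr_anti X]gr_mulE !gr_antiE [RHS]gr_mulE /= !zD !zM.
by congr (\pi_(gr S) (_, _)); rewrite addrC.
Qed.

Lemma gr_anti1 : gr_anti 1 = 1.
Proof. by rewrite -[in LHS]/(gr_inj 1) gr_anti_inj z1. Qed.

Lemma gr_anti0 : gr_anti 0 = 0.
Proof. by rewrite -[in LHS]/(gr_inj 0) gr_anti_inj z0. Qed.

(** Over a noncommutative ring transposition alone does not reverse matrix products, but combined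
    with an anti-endomorphism of the entries it does. Left and right inverses are thereby
    interchanged. *)
Lemma gr_anti_mulmx n (A B : 'M[gr S]_n) : A *m B = 1%:M ->
  (map_mx gr_anti B)^T *m (map_mx gr_anti A)^T = 1%:M.
Proof.
move=> /matrixP AB; apply/matrixP => i j; rewrite !mxE.
transitivity (gr_anti (\sum_k A j k * B k i)).
  rewrite (big_morph gr_anti gr_antiD gr_anti0).
  by apply: eq_bigr => k _; rewrite !mxE gr_antiM.
have := AB j i; rewrite !mxE => ->.
by rewrite eq_sym; case: eqP => _; rewrite ?gr_anti1 ?gr_anti0.
Qed.

End GroupCompletionMap.

Section GLZeta.
Variables (R : bimonoidal) (Z : anti_involution R).
Local Notation cls := (@pi0_class R).

Definition pi0_zeta (x : pi0 R) : pi0 R := cls (zeta Z (repr x)).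

Lemma pi0_zetaE a : pi0_zeta (cls a) = cls (zeta Z a).
Proof.
apply: (pi0_lift (F := fun a => cls (zeta Z a))) => f.
by have [<- <-] := fmor_hom (zeta Z) f; exact: pi0_mor.
Qed.

(** On path components zeta is an anti-endomorphism of the rig, [mu] connecting the image of a
    product to the reversed product. The inverse of the new matrix is the conjugate transpose of the
    old inverse. *)
Lemma GL_zeta_t n (A : 'M[ob R]_n) : GL A -> GL (zeta_t Z A).
Proof.
have z0 : pi0_zeta 0%R = 0%R by rewrite pi0_zetaE zeta_zero.
have z1 : pi0_zeta 1%R = 1%R by rewrite pi0_zetaE zeta_one.
have zD : {morph pi0_zeta : x y / (x + y)%R}.
  elim/pi0_ind=> a; elim/pi0_ind=> b.
  by rewrite [X in pi0_zeta X]pi0_addE !pi0_zetaE [RHS]pi0_addE zeta_oplus.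
have zM : {morph pi0_zeta : x y / (x * y)%R >-> (y * x)%R}.
  elim/pi0_ind=> a; elim/pi0_ind=> b.
  rewrite [X in pi0_zeta X]pi0_mulE !pi0_zetaE [RHS]pi0_mulE.
  by have [<- <-] := mu_hom Z a b; exact: pi0_mor.
move=> [B [AB BA]]; exists (map_mx (gr_anti pi0_zeta) B)^T%R.
suff -> : map_mx (fun x : ob R => gr_inj (cls x)) (zeta_t Z A) =
    (map_mx (gr_anti pi0_zeta)
      (map_mx (fun x : ob R => gr_inj (cls x)) A))^T%R.
  by split; apply: gr_anti_mulmx.
by apply/matrixP => i j; rewrite !mxE (gr_anti_inj z0 zD) pi0_zetaE.
Qed.

End GLZeta.

(** * The map tau *)

#[local] Hint Rewrite dom_idm cod_idm : mtyping.
#[local] Hint Rewrite zetam_t_dom zetam_t_cod MmuV_dom MmuV_cod Mmor_dom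
  Mmor_cod : mtyping.
(** The counterpart of [typ] for categories of matrices. *)
Ltac mtyp := repeat first
  [ done
  | match goal with
    | H : dom _ = _ |- _ => progress rewrite !H
    | H : cod _ = _ |- _ => progress rewrite !H
    end
  | progress autorewrite with mtyping
  | rewrite dom_comp; last solve [mtyp]
  | rewrite cod_comp; last solve [mtyp] ].

Section Tau.
Variables (R : bimonoidal) (Z : anti_involution R) (n : nat).
Local Notation T := (mattensor R n).
Local Notation M := (matcat R n).
Local Notation zeta_t := (zeta_t Z).
Local Notation zetam_t := (zetam_t Z).

Lemma zetam_t_hom (f : mor M) :
  @hom M (zeta_t (dom f)) (zeta_t (cod f)) (zetam_t f).
Proof. by split; rewrite ?zetam_t_dom ?zetam_t_cod. Qed.

(** Lets [fmor_inverse] carry isomorphisms along conjugate transposition. *)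
Definition zeta_t_functor : functor M M :=
  @Functor M M (@Defs.zeta_t R Z n) (@Defs.zetam_t R Z n) zetam_t_hom
    (@zetam_t_idm R Z n)
    (@zetam_t_comp R Z n).

Lemma Massoc_hom (A B C : ob M) :
  @hom M (Mob (Mob A B) C) (Mob A (Mob B C)) (Massoc A B C).
Proof.
split; apply/matrixP => i l; rewrite [LHS]mxE [Massoc _ _ _ _ _]mxE; typ.
(* The source is a sum of products [(A . B) C]; it agrees with the expanded double sum because left
   distributivity is an equality. *)
- rewrite MobE; apply: eq_bsum => k.
  by rewrite MobE otimes_bsum.
- by rewrite MobE; apply: eq_bsum => j; typ; rewrite MobE.
Qed.

(** The cocycle condition for tau, freed from vertices and their reversal. Conjugate transposition
    interchanges the two bracketings, so each side of the conclusion comes from the opposite side of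
    the hypothesis. *)
Lemma cocycle_zeta_t (A B C D E F : ob M) (f1 f2 f3 f4 : mor M) :
    hom (mob T B C) D f1 -> hom (mob T A D) F f2 ->
    hom (mob T A B) E f3 -> hom (mob T E C) F f4 ->
    f4 \oc mmor T f3 (idm C) = f2 \oc (mmor T (idm A) f1 \oc massoc T A B C) ->
  ((zetam_t f2 : mor M) \oc MmuV Z A D) \oc
    mmor T ((zetam_t f1 : mor M) \oc MmuV Z B C) (idm (zeta_t A : ob M)) =
  ((zetam_t f4 : mor M) \oc MmuV Z E C) \oc
    (mmor T (idm (zeta_t C : ob M)) ((zetam_t f3 : mor M) \oc MmuV Z A B) \oc
     massoc T (zeta_t C) (zeta_t B) (zeta_t A)).
Proof.
move=> [d1 c1] [d2 c2] [d3 c3] [d4 c4] e.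
have [da ca] := Massoc_hom A B C.
have [da' ca'] := Massoc_hom (zeta_t C) (zeta_t B) (zeta_t A).
have := MmuV_nat Z (idm A : mor M) f1.
rewrite dom_idm cod_idm d1 c1 zetam_t_idm => n1.
have := MmuV_nat Z f3 (idm C : mor M).
rewrite dom_idm cod_idm d3 c3 zetam_t_idm => n2.
have -> : mmor T ((zetam_t f1 : mor M) \oc MmuV Z B C) (idm (zeta_t A : ob M)) =
    mmor T (zetam_t f1) (idm (zeta_t A : ob M)) \oc
      mmor T (MmuV Z B C) (idm (zeta_t A : ob M)).
  by rewrite -mmor_comp ?comp_idm; mtyp.
have -> : mmor T (idm (zeta_t C : ob M)) ((zetam_t f3 : mor M) \oc MmuV Z A B) =
    mmor T (idm (zeta_t C : ob M)) (zetam_t f3) \oc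
      mmor T (idm (zeta_t C : ob M)) (MmuV Z A B).
  by rewrite -mmor_comp ?comp_idm; mtyp.
change (mmor T) with (@Mmor R n) in *; change (mob T) with (@Mob R n) in *.
change (massoc T) with (@Massoc R n) in *.
(* Naturality [n1] gathers [f1] and [f2] under a single conjugate transpose; [MmuV_assoc] then
   brings the associator under it too, and [e] applies there. *)
transitivity ((zetam_t (f2 \oc Mmor (idm A) f1) : mor M) \oc
    ((MmuV Z A (Mob B C) : mor M) \oc
      Mmor (MmuV Z B C) (idm (zeta_t A : ob M)))).
  rewrite zetam_t_comp; [|mtyp..].
  rewrite -[LHS]compA; [|mtyp..].
  rewrite [X in _ \oc X = _]compA; [|mtyp..].
  by rewrite -n1 -[RHS]compA ?[X in _ = _ \oc X]compA; mtyp.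
rewrite MmuV_assoc.
rewrite compA; [|mtyp..].
rewrite -zetam_t_comp; [|mtyp..].
rewrite -[f2 \oc _ \oc _]compA; [|mtyp..].
rewrite -e zetam_t_comp; [|mtyp..].
rewrite -[LHS]compA; [|mtyp..].
rewrite -[RHS]compA; [|mtyp..].
congr (_ \oc _).
rewrite -[X in _ \oc X = _]compA; [|mtyp..].
rewrite -[X in _ = _ \oc X]compA; [|mtyp..].
rewrite [LHS]compA; [|mtyp..].
by rewrite n2 -[LHS]compA; mtyp.
Qed.

Lemma square_zeta_t (A B D A' B' D' : ob M) (p p' f g h : mor M) :
    hom (mob T A B) D p -> hom (mob T A' B') D' p' -> hom A A' f ->
    hom B B' g -> hom D D' h -> h \oc p = p' \oc mmor T f g ->
  (zetam_t h : mor M) \oc ((zetam_t p : mor M) \oc MmuV Z A B) =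
  ((zetam_t p' : mor M) \oc MmuV Z A' B') \oc
    mmor T (zetam_t g) (zetam_t f).
Proof.
move=> [d c] [d' c'] [df cf] [dg cg] [dh ch] e.
have := MmuV_nat Z f g; rewrite df cf dg cg => nat.
change (mmor T) with (@Mmor R n) in *; change (mob T) with (@Mob R n) in *.
rewrite compA; [|mtyp..].
rewrite -zetam_t_comp; [|mtyp..].
rewrite e zetam_t_comp; [|mtyp..].
rewrite -[LHS]compA; [|mtyp..].
by rewrite nat compA; mtyp.
Qed.

Section Level.
Variable q : nat.
Local Notation V := 'I_q.+1.
Implicit Types (x : ob (BGL R n q)).

Lemma rev_ord_lt (i j : V) : (rev_ord j < rev_ord i)%N = (i < j)%N.
Proof. by rewrite /= !subSS ltn_sub2lE // -ltnS. Qed.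

Definition tau_A x (i j : V) : ob M := zeta_t (bA x (rev_ord j) (rev_ord i)).

(** The defining formula of tau before normalization, kept separate because it remains valid for
    weakly increasing vertices. *)
Definition tau_psi x (i j k : V) : mor M :=
  (zetam_t (bphi x (rev_ord k) (rev_ord j) (rev_ord i)) : mor M) \oc
  (MmuV Z (bA x (rev_ord k) (rev_ord j)) (bA x (rev_ord j) (rev_ord i))
    : mor M).

Definition tau_phi x (i j k : V) : mor M :=
  if (i < j < k)%N then tau_psi x i j k else idm (tau_A x i k).

Lemma tau_A_GL x (i j : V) : (i < j)%N -> GL (tau_A x i j).
Proof. by rewrite -rev_ord_lt => /(bA_sub x)/(GL_zeta_t Z). Qed.

Lemma tau_A_norm x (i j : V) : ~~ (i < j)%N -> tau_A x i j = mone T.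
Proof.
by rewrite -rev_ord_lt => /(bA_norm x) e; rewrite /tau_A e; exact: zeta_t_one.
Qed.

Lemma tau_psi_hom x (i j k : V) : (i < j < k)%N ->
  hom (mob T (tau_A x i j) (tau_A x j k)) (tau_A x i k) (tau_psi x i j k).
Proof.
(* Reversal flips both inequalities and also their order in the conjunction. *)
rewrite andbC -rev_ord_lt -[X in _ && X]rev_ord_lt => /(bphi_hom x)[d c].
apply: (@hom_comp M _ (zeta_t (mob T (bA x (rev_ord k) (rev_ord j))
  (bA x (rev_ord j) (rev_ord i))))).
  by split; [exact: MmuV_dom|exact: MmuV_cod].
by split; rewrite ?zetam_t_dom ?zetam_t_cod ?d ?c.
Qed.

Lemma tau_phi_hom x (i j k : V) : (i < j < k)%N ->
  hom (mob T (tau_A x i j) (tau_A x j k)) (tau_A x i k) (tau_phi x i j k).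
Proof. by move=> ijk; rewrite /tau_phi ijk; exact: tau_psi_hom. Qed.


Lemma tau_phi_iso x (i j k : V) : (i < j < k)%N -> is_iso (tau_phi x i j k).
Proof.
move=> ijk; rewrite /tau_phi ijk.
move: ijk; rewrite andbC -rev_ord_lt -[X in _ && X]rev_ord_lt => ijk.
have [d c] := bphi_hom x ijk.
apply: is_iso_comp; last 1 first.
- have [g gP] := bphi_iso x ijk.
  by exists (zetam_t g); exact: (fmor_inverse zeta_t_functor gP).
- by rewrite zetam_t_dom d; exact: MmuV_cod.
- exact: MmuV_iso.
Qed.

Lemma tau_phi_norm x (i j k : V) : ~~ (i < j < k)%N ->
  tau_phi x i j k = idm (tau_A x i k).
Proof. by move=> /negPf ijk; rewrite /tau_phi ijk. Qed.

(* Both sides reduce by naturality of [MmuV] to the image under zeta of the two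
   sides of the cocycle condition of [x], matched by [MmuV_assoc]. *)
Lemma tau_phi_coh x (i j k l : V) : [&& i < j, j < k & k < l]%N ->
  tau_phi x i k l \oc mmor T (tau_phi x i j k) (idm (tau_A x k l)) =
  tau_phi x i j l \oc (mmor T (idm (tau_A x i j)) (tau_phi x j k l)
    \oc massoc T (tau_A x i j) (tau_A x j k) (tau_A x k l)).
Proof.
move=> /and3P[ij jk kl].
rewrite /tau_phi ij jk kl (ltn_trans ij jk) (ltn_trans jk kl) /=.
have kj : (rev_ord k < rev_ord j)%N by rewrite rev_ord_lt.
have ji : (rev_ord j < rev_ord i)%N by rewrite rev_ord_lt.
have lk : (rev_ord l < rev_ord k)%N by rewrite rev_ord_lt.
rewrite /tau_psi /tau_A.
(* From here on only the reversed vertices occur, and they satisfy l < k < j < i. *)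
move: (rev_ord i) (rev_ord j) (rev_ord k) (rev_ord l) kj ji lk.
move=> {ij jk kl}i {}j {}k {}l kj ji lk.
have [ki lj] := (ltn_trans kj ji, ltn_trans lk kj).
have kji : (k < j < i)%N by rewrite kj.
have lkj : (l < k < j)%N by rewrite lk.
have lki : (l < k < i)%N by rewrite lk.
have lji : (l < j < i)%N by rewrite lj.
apply: (cocycle_zeta_t (bphi_hom x kji) (bphi_hom x lki) (bphi_hom x lkj)
  (bphi_hom x lji)).
by apply: bphi_coh; rewrite lk kj.
Qed.

(** [tilde] changes the operators but not the levels, so the values lie in the same category and tau
    can be iterated. *)
Definition tau_ob x : ob (BGL R n q) :=
  @BarOb M T (@GL R n) q (tau_A x) (tau_phi x) (@tau_A_GL x) (@tau_A_norm x)
    (@tau_phi_hom x) (@tau_phi_iso x) (@tau_phi_norm x) (@tau_phi_coh x).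

Implicit Types (f g : mor (BGL R n q)).

Definition tau_f f (i j : V) : mor M := zetam_t (bf f (rev_ord j) (rev_ord i)).

Lemma tau_f_hom f i j :
  hom (bA (tau_ob (dom f)) i j) (bA (tau_ob (cod f)) i j) (tau_f f i j).
Proof.
have [d c] := bf_hom f (rev_ord j) (rev_ord i).
by split; rewrite ?zetam_t_dom ?zetam_t_cod ?d ?c.
Qed.

Lemma tau_f_norm f (i j : V) : ~~ (i < j)%N -> tau_f f i j = idm (mone T).
Proof.
rewrite -rev_ord_lt => /(bf_norm f) e; rewrite /tau_f e zetam_t_idm.
by rewrite zeta_t_one.
Qed.

Lemma tau_f_nat f (i j k : V) : (i < j < k)%N ->
  tau_f f i k \oc bphi (tau_ob (dom f)) i j k =
  bphi (tau_ob (cod f)) i j k \oc mmor T (tau_f f i j) (tau_f f j k).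
Proof.
move=> ijk; transitivity (tau_f f i k \oc tau_phi (dom f) i j k); first by [].
transitivity (tau_phi (cod f) i j k \oc mmor T (tau_f f i j) (tau_f f j k));
  last by [].
rewrite /tau_phi ijk; move: ijk.
rewrite andbC -rev_ord_lt -[X in _ && X]rev_ord_lt => ijk.
apply: (square_zeta_t (bphi_hom (dom f) ijk) (bphi_hom (cod f) ijk)
  (bf_hom f _ _) (bf_hom f _ _) (bf_hom f _ _)).
exact: bf_nat.
Qed.

Definition tau_mor f : mor (BGL R n q) :=
  @BarMor M T (@GL R n) q (tau_ob (dom f)) (tau_ob (cod f)) (tau_f f)
    (@tau_f_hom f) (@tau_f_norm f) (@tau_f_nat f).

Lemma tau_mor_hom f : @hom (tilde (BGL R n) q) (tau_ob (dom f)) (tau_ob (cod f))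
  (tau_mor f).
Proof. by []. Qed.

Lemma tau_mor_id x : tau_mor (idm x) = idm (tau_ob x).
Proof. by apply: bar_mor_eq => // i j; exact: zetam_t_idm. Qed.

Lemma tau_mor_comp g f : cod f = dom g ->
  tau_mor (g \oc f) = tau_mor g \oc tau_mor f.
Proof.
rewrite -[dom g]/(bsrc g) -[cod f]/(btgt f).
move=> fg.
(* [bar_comp] has the entrywise formula only on composable pairs. *)
have fg' : btgt (tau_mor f) = bsrc (tau_mor g) by exact: (congr1 tau_ob fg).
apply: bar_mor_eq.
- by rewrite [RHS]bar_dom_comp //= bar_dom_comp.
- by rewrite [RHS]bar_cod_comp //= bar_cod_comp.
- move=> i j; rewrite [X in _ = bf X _ _](bar_compE fg') /=.
  rewrite /tau_f [X in bf X](bar_compE fg) /=.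
  rewrite -/(@comp M _ _) zetam_t_comp //.
  have [_ ->] := bf_hom f (rev_ord j) (rev_ord i).
  by have [-> _] := bf_hom g (rev_ord j) (rev_ord i); rewrite fg.
Qed.

Definition tau : functor (BGL R n q) (tilde (BGL R n) q) :=
  @Functor (BGL R n q) (tilde (BGL R n) q) tau_ob tau_mor tau_mor_hom
    tau_mor_id tau_mor_comp.

Lemma tau_is_tau : is_tau Z tau.
Proof. by split=> // x i j k ijk; rewrite /= /tau_phi ijk. Qed.

End Level.
End Tau.

Lemma bar_ob_eq (C : cat) (T : tensor_data C) (P : ob C -> Prop) q
    (x y : bar_ob T P q) : (forall i j, bA x i j = bA y i j) ->
  (forall i j k, bphi x i j k = bphi y i j k) -> x = y.
Proof.
case: x y => [A f x1 x2 x3 x4 x5 x6] [A' f' y1 y2 y3 y4 y5 y6] /= AA' ff'.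
have {}AA' : A = A' by apply/funext => i; apply/funext => j.
have {}ff' : f = f' by do 3!apply/funext => ?.
by subst; congr BarOb; apply: Prop_irrelevance.
Qed.

Lemma chain_eq (C : cat) m (x y : chain C m) :
  (forall i, ch_ob x i = ch_ob y i) ->
  (forall i j, ch_mor x i j = ch_mor y i j) -> x = y.
Proof.
case: x y => [a f x1 x2 x3] [a' f' y1 y2 y3] /= aa' ff'.
have {}aa' : a = a' by apply/funext.
have {}ff' : f = f' by do 2!apply/funext => ?.
by subst; congr Chain; apply: Prop_irrelevance.
Qed.

(** * Tau and simplicial operators, involutivity, and block sums *)

Section TauProperties.
Variables (R : bimonoidal) (Z : anti_involution R).

Section Simplicial.
Variable n : nat.
Local Notation M := (matcat R n).

(* The degenerate cases rely on [mu] being the identity when one of its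
   arguments is 0 or 1. *)
Lemma tau_phi_weak q (x : ob (BGL R n q)) (i j k : 'I_q.+1) : (i <= j <= k)%N ->
  tau_phi Z x i j k = tau_psi Z x i j k.
Proof.
rewrite /tau_phi; case: ifPn => // ijk /andP[ij jk].
rewrite /tau_psi bphi_norm; last first.
  by apply: contra ijk; rewrite !rev_ord_lt andbC.
rewrite zetam_t_idm /tau_A.
(* If i = j the second argument of [MmuV] is the unit matrix; otherwise j = k and the first one
   is. *)
have [eij|nij] := eqVneq i j.
  rewrite eij (bA_norm x (i := rev_ord j) (j := rev_ord j)) ?ltnn //.
  by rewrite [X in _ \oc X](MmuV_1r Z) comp_idm.
have -> : j = k.
  apply: val_inj; apply/eqP; move: ijk; rewrite ltn_neqAle nij ij /=.
  by rewrite ltn_neqAle jk andbT negbK.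
rewrite (bA_norm x (i := rev_ord k) (j := rev_ord k)) ?ltnn //.
by rewrite [X in _ \oc X](MmuV_1l Z) comp_idm.
Qed.

Lemma tau_sc_ob p q (a : dmap p q) (x : ob (BGL R n q)) (y : ob (BGL R n p)) :
  sc_ob a x y -> sc_ob (rev_dmap a) (tau_ob Z x) (tau_ob Z y).
Proof.
move=> [yA yphi]; split=> [i j|i j k].
  by rewrite /= /tau_A yA !rev_ordK.
rewrite -[LHS]/(tau_phi Z y i j k) -[RHS]/(tau_phi Z x _ _ _).
have [ijk|ijk] := boolP (i < j < k)%N.
  have /andP[ij jk] := ijk.
  (* The map [a] may identify vertices, so the image triple is only weakly increasing. *)
  rewrite !tau_phi_weak ?(ltnW ij) ?(ltnW jk) //; last first.
    by rewrite !dfun_homo // ltnW.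
  by rewrite /tau_psi yphi !yA !rev_ordK.
rewrite !tau_phi_norm //; first by rewrite /tau_A yA !rev_ordK.
(* A monotone map reflects strict inequalities, hence a triple that is normalized stays so under
   [a]. *)
apply: contra ijk => /andP[ij jk].
by apply/andP; split; rewrite ltnNge; [apply: contraL ij|apply: contraL jk];
  rewrite -leqNgt; apply: dfun_homo.
Qed.

Lemma tau_simplicial : simplicial_functor (@tau R Z n).
Proof.
split=> p q a; first exact: tau_sc_ob.
move=> f g [sA sphi tA tphi fg].
have [s1 s2] := tau_sc_ob (conj sA sphi).
have [t1 t2] := tau_sc_ob (conj tA tphi).
by split=> // i j; rewrite /= /tau_f fg !rev_ordK.
Qed.

(** Applying tau twice leaves zeta of one reversal composed with another, and these cancel by
    [MmuV_zeta]. *)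
Lemma tau_obK q (x : ob (BGL R n q)) : tau_ob Z (tau_ob Z x) = x.
Proof.
apply: bar_ob_eq => [i j|i j k] /=.
  by rewrite /tau_A /= /tau_A !rev_ordK zeta_tK.
have [ijk|ijk] := boolP (i < j < k)%N; last first.
  rewrite tau_phi_norm // bphi_norm //.
  by rewrite /tau_A /= /tau_A !rev_ordK zeta_tK.
rewrite /tau_phi ijk /tau_psi /= /tau_phi !rev_ord_lt andbC ijk /tau_A /tau_psi.
rewrite !rev_ordK -/(@comp M _ _).
have [d c] := bphi_hom x ijk.
rewrite -[Mcomp (zetam_t _ _) _]/(@comp M _ _).
rewrite zetam_t_comp; [|mtyp..].
rewrite zetam_tK -[LHS]compA; [|by mtyp; rewrite ?zeta_tK..].
by rewrite MmuV_zeta comp_idr_eq; mtyp; rewrite zeta_tK.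
Qed.

Lemma tau_morK q (f : mor (BGL R n q)) : tau_mor Z (tau_mor Z f) = f.
Proof.
apply: bar_mor_eq => [||i j]; rewrite /= ?tau_obK //.
by rewrite /tau_f /= /tau_f !rev_ordK zetam_tK.
Qed.

Definition tau_chain q m (x : chain (BGL R n q) m) : chain (BGL R n q) m :=
  nerve_map (tau Z n q) x.

Lemma tau_chainK q m : involutive (@tau_chain q m).
Proof.
by move=> x; apply: chain_eq => *; [exact: tau_obK|exact: tau_morK].
Qed.

End Simplicial.

Section BlockSum.
Variables n m : nat.

Lemma zeta_t_block (A : 'M[ob R]_n) (B : 'M[ob R]_m) :
  zeta_t Z (bsum_ob A B) = bsum_ob (zeta_t Z A) (zeta_t Z B).
Proof.
rewrite /zeta_t /bsum_ob map_block_mx tr_block_mx.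
by rewrite !map_const_mx !trmx_const zeta_zero.
Qed.

Lemma zetam_t_block (f : 'M[mor R]_n) (g : 'M[mor R]_m) :
  zetam_t Z (bsum_mor f g) = bsum_mor (zetam_t Z f) (zetam_t Z g).
Proof.
rewrite /zetam_t /bsum_mor map_block_mx tr_block_mx.
by rewrite !map_const_mx !trmx_const zetam_idm0.
Qed.

Lemma Mid_block (A : 'M[ob R]_n) (B : 'M[ob R]_m) :
  @idm (matcat R (n + m)) (bsum_ob A B) =
  bsum_mor (@idm (matcat R n) A) (@idm (matcat R m) B).
Proof. by rewrite /= /bsum_ob map_block_mx !map_const_mx. Qed.

Lemma Mcomp_block (f f' : 'M[mor R]_n) (g g' : 'M[mor R]_m) :
  Mcomp (bsum_mor f' g') (bsum_mor f g) =
  bsum_mor (Mcomp f' f) (Mcomp g' g).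
Proof.
apply/matrixP => i j; rewrite -(fintype.splitK i) -(fintype.splitK j).
by case: (fintype.split i) (fintype.split j) => [{}i|{}i] [{}j|{}j] /=;
  rewrite [LHS]mxE /bsum_mor
    ?(block_mxEul, block_mxEur, block_mxEdl, block_mxEdr)
    !mxE ?comp_idm.
Qed.

(** Split the summation index into the two blocks: each summand with a zero argument is the identity
    of zero by [muV0l] or [muV0r]. This makes tau strictly compatible with block sums. *)
Lemma MmuV_block (A B : 'M[ob R]_n) (A' B' : 'M[ob R]_m) :
  MmuV Z (bsum_ob A A') (bsum_ob B B') = bsum_mor (MmuV Z A B) (MmuV Z A' B').
Proof.
apply/matrixP => i j.
rewrite MmuVE big_split_ord -(fintype.splitK i) -(fintype.splitK j).
case: (fintype.split i) (fintype.split j) => [{}i|{}i] [{}j|{}j] /=;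
  under eq_bigr do rewrite ?(block_mxEul, block_mxEur, block_mxEdl, block_mxEdr)
    ?mxE ?muV0l ?muV0r;
  under [X in _ <+m> X]eq_bigr do
    rewrite ?(block_mxEul, block_mxEur, block_mxEdl, block_mxEdr)
    ?mxE ?muV0l ?muV0r;
  rewrite /bsum_mor ?(block_mxEul, block_mxEur, block_mxEdl, block_mxEdr)
    ?MmuVE ?mxE ?big1_eq ?oplusm0o ?oplusmo0 //.
Qed.

Section Chains.
Variable q : nat.

Lemma tau_phi_block (x : ob (BGL R n q)) (y : ob (BGL R m q))
    (z : ob (BGL R (n + m) q)) i j k :
    (forall i j, bA z i j = bsum_ob (bA x i j) (bA y i j)) ->
    (forall i j k, bphi z i j k = bsum_mor (bphi x i j k) (bphi y i j k)) ->
  bphi (tau_ob Z z) i j k =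
  bsum_mor (bphi (tau_ob Z x) i j k) (bphi (tau_ob Z y) i j k).
Proof.
move=> zA zphi; rewrite -[LHS]/(tau_phi Z z i j k).
rewrite -[bphi (tau_ob Z x) _ _ _]/(tau_phi Z x i j k).
rewrite -[bphi (tau_ob Z y) _ _ _]/(tau_phi Z y i j k) /tau_phi.
case: ifP => _.
  by rewrite /tau_psi zphi !zA zetam_t_block MmuV_block [LHS]Mcomp_block.
by rewrite /tau_A zA zeta_t_block Mid_block.
Qed.

Lemma tau_block_sum l (x : chain (BGL R n q) l) (y : chain (BGL R m q) l)
    (z : chain (BGL R (n + m) q) l) :
  is_block_sum x y z ->
  is_block_sum (tau_chain x) (tau_chain y) (tau_chain z).
Proof.
move=> [zA zphi zf]; split=> [u i j|u i j k|u v i j].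
- by rewrite /= /tau_A zA zeta_t_block.
- exact: tau_phi_block.
- by rewrite /= /tau_f zf zetam_t_block.
Qed.

End Chains.

End BlockSum.

(** There is only one matrix of size zero, so all data of the unit are forced. *)
Lemma tau_chain_point : tau_chain (chain_point R) = chain_point R.
Proof.
have flat (A B : 'M[ob R]_0) : A = B by apply/matrixP => -[].
have flatm (f g : 'M[mor R]_0) : f = g by apply/matrixP => -[].
have ptE : tau_ob Z (bar_point R) = bar_point R by apply: bar_ob_eq.
apply: chain_eq => [i|i j] //.
apply: bar_mor_eq => //.
Qed.

End TauProperties.

(** * Realizations and loops *)

Local Open Scope quotient_scope.
Local Open Scope classical_set_scope.

Section Continuity.

Lemma continuous_ptws (T : topologicalType) (I : Type)
    (K : I -> topologicalType) (f : T -> prod_topology K) :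
  (forall i, continuous (fun x => f x i)) -> continuous f.
Proof.
move=> cf x; apply/cvg_sup => i.
apply: (@continuous_comp_initial _ _ _ (fun g : forall i, K i => g i) f).
exact: cf.
Qed.

Lemma continuous_set_type (T X : topologicalType) (A : set X)
    (f : T -> set_type A) :
  continuous (set_val \o f) -> continuous f.
Proof. exact: continuous_comp_initial. Qed.

(** A test map into [T] followed by [f] is a test map into [U]. *)
Lemma continuous_kelley (T U : topologicalType) (f : T -> U) :
  continuous f -> continuous (f : kelley T -> kelley U).
Proof.
move=> cf; apply/continuousP => A oA.
move=> Z u cZ hZ cu; apply: (oA Z (f \o u)) => // z.
by apply: continuous_comp; [exact: cu|exact: cf].
Qed.

Definition postcomp (T U V : topologicalType) (f : U -> V)
  (g : {compact-open, T -> U}) : {compact-open, T -> V} := f \o g.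

(** Sending [K] into [O] after composing with [f] means sending [K] into the preimage of [O], which
    is again a subbasic open condition. *)
Lemma postcomp_continuous (T U V : topologicalType) (f : U -> V) :
  continuous f -> continuous (@postcomp T U V f).
Proof.
move=> cf g; have FF : Filter (nbhs g) by exact: nbhs_filter.
have FF' := @fmap_filter _ _ (postcomp f) _ FF.
apply/compact_open_cvgP => K O cK oO fgK.
have oO' : open (f @^-1` O) by move/continuousP: cf; apply.
have gK : g @` K `<=` f @^-1` O by move=> _ [x Kx <-]; apply: fgK; exists x.
have oKO := compact_open_open cK oO'.
have : nbhs g [set h : {compact-open, T -> U} | h @` K `<=` f @^-1` O].
  exact: open_nbhs_nbhs.
by apply: filterS => h hK _ [x Kx <-]; apply: hK; exists x.
Qed.

Lemma continuous_discrete (T : choiceType) (U : topologicalType)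
  (f : discrete_topology T -> U) : continuous f.
Proof.
apply/(@continuousP (discrete_topology T) U f) => A _.
exact: (@discrete_open (discrete_topology T)).
Qed.

End Continuity.

Section RealizationMaps.
Variable K : realType.

Lemma coord_continuous q (i : 'I_q.+1) :
  continuous (fun s : simplex K q => (set_val s : _ -> K) i).
Proof.
have cv : continuous (set_val : simplex K q -> {ptws 'I_q.+1 -> K}).
  exact: initial_continuous.
move=> s; apply: (@continuous_comp (simplex K q) {ptws 'I_q.+1 -> K} K set_val
  (proj i)); first exact: cv.
exact: proj_continuous.
Qed.

Lemma srev_continuous q : continuous (@srev K q).
Proof.
apply: continuous_set_type; apply: continuous_ptws => i.
exact: (@coord_continuous q (rev_ord i)).
Qed.

Lemma rpt_continuous (X : simplicial_space) q :
  continuous (fun u : X q * simplex K q => rpt u.1 u.2).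
Proof.
rewrite (_ : (fun u => _) =
  (\pi_(realization K X) \o existT (fun q => (X q * simplex K q)%type) q)).
  move=> u; apply: continuous_comp; first exact: existT_continuous.
  exact: pi_continuous.
by apply/funext => -[].
Qed.

(* The simplex coordinates may be moved along with the space, as when reversing
   them. *)
Lemma realization_lift (X Y : simplicial_space) (f : forall q, X q -> Y q)
    (h : forall q, simplex K q -> simplex K q) :
    (forall q, continuous (f q)) -> (forall q, continuous (h q)) ->
    (forall p q (a : dmap p q) x y s, ss_op a x y ->
      rpt (f q x) (h q (push a s)) = rpt (f p y) (h p s)) ->
  exists F : realization K X -> realization K Y,
    continuous F /\ forall q x s, F (rpt x s) = rpt (f q x) (h q s).
Proof.
move=> cf ch fh.
pose g (u : presentation K X) : realization K Y :=
  rpt (f (tag u) (tagged u).1) (h (tag u) (tagged u).2).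
have g_glue u v :
    \pi_(realization K X) u = \pi_(realization K X) v -> g u = g v.
  move=> /eqmodP/asboolP; elim=> {u v} [u v []|//|u v _ ->//|u v w _ -> _ ->//].
  by move=> p q a x y s; exact: fh.
exists (g \o repr); split.
  (* As [g] respects the gluing, continuity descends from the disjoint union, where it is checked on
     each summand. *)
  apply: repr_comp_continuous; last by move=> u v /eqP/g_glue/eqP.
  apply/continuousP => A oA; apply/sigT_openP => q.
  suff /continuousP : continuous (g \o existT _ q) by apply.
  move=> v; apply: (@continuous_comp (X q * simplex K q)%type
    (Y q * simplex K q)%type (realization K Y)
    (fun v => (f q v.1, h q v.2)) (fun u => rpt u.1 u.2));
    last exact: rpt_continuous.
  apply: (@cvg_pair _ _ _ (nbhs v) (nbhs (f q v.1)) (nbhs (h q v.2)) _ _ _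
    (fun v => f q v.1) (fun v => h q v.2)).
    by apply: (@continuous_comp _ _ _ fst (f q)); [exact: cvg_fst|exact: cf].
  by apply: (@continuous_comp _ _ _ snd (h q)); [exact: cvg_snd|exact: ch].
move=> q x s; rewrite -[RHS]/(g (existT _ q (x, s))) /=; apply: g_glue.
by rewrite reprK.
Qed.

Lemma rpt_glue (X : simplicial_space) p q (a : dmap p q) (x : X q) (y : X p)
    (s : simplex K p) :
  ss_op a x y -> rpt x (push a s) = rpt y s.
Proof.
move=> xy; apply/eqmodP/asboolP; apply: Relation_Operators.rst_step.
exact: Glue.
Qed.

Lemma rpt_surj (X : simplicial_space) (u : realization K X) :
  exists q (x : X q) s, u = rpt x s.
Proof.
move: (reprK u); case: (repr u) => q [x s] e.
by exists q, x, s; rewrite -e.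
Qed.

Lemma realization_map (X Y : simplicial_space) (f : forall q, X q -> Y q) :
    (forall q, continuous (f q)) ->
    (forall p q (a : dmap p q) x y, ss_op a x y -> ss_op a (f q x) (f p y)) ->
  exists F : realization K X -> realization K Y, realizes f F.
Proof.
move=> cf fop; have ch q : continuous (id : simplex K q -> simplex K q).
  by move=> s; exact: cvg_id.
apply: (realization_lift cf ch) => p q a x y s xy.
exact/rpt_glue/fop.
Qed.

Lemma nerve_realization_map (C D : cat) (F : functor C D) :
  exists G, @realizes K (nerve C) (nerve D) (@nerve_map C D F) G.
Proof.
apply: realization_map => [m|p q a x y [xo xm]].
  exact: continuous_discrete.
by split=> [i|i j] /=; rewrite ?xo ?xm.
Qed.

Lemma cat_realization_map (X Y : simplicial_cat)
    (F : forall q, functor (X q) (Y q)) :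
  simplicial_functor F -> exists G, @cat_realizes K X Y F G.
Proof.
move=> [Fo Fm].
(* The realized maps of the levels are only known to exist, so one is chosen in each degree. *)
pose L q := sval (cid (nerve_realization_map (F q))).
have LP q : realizes _ (L q) := svalP (cid (nerve_realization_map (F q))).
have [||G [cG GP]] := @realization_map (level_realization K X)
    (level_realization K Y) L.
- by move=> q; have [] := LP q.
- move=> p q a u v [m [x [y [s [-> -> xyo xym]]]]].
  exists m, (nerve_map (F q) x), (nerve_map (F p) y), s.
  have [[_ Lq] [_ Lp]] := (LP q, LP p); split; rewrite ?Lq ?Lp // => *.
    exact: Fo.
  exact: Fm.
exists G; split=> // q m x s t; have [_ Lq] := LP q.
by rewrite /cat_rpt GP Lq.
Qed.

Lemma srevE q (s : simplex K q) i :
  (set_val (srev s) : _ -> K) i = (set_val s : _ -> K) (rev_ord i).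
Proof. by rewrite set_valE. Qed.

Lemma pushE p q (a : dmap p q) (s : simplex K p) j :
  (set_val (push a s) : _ -> K) j =
  (\sum_(i | a i == j) (set_val s : _ -> K) i)%R.
Proof. by rewrite set_valE. Qed.

Lemma simplex_eq q (s t : simplex K q) :
  (set_val s : _ -> K) =1 (set_val t : _ -> K) -> s = t.
Proof. by rewrite !set_valE => /funext/val_inj. Qed.

Lemma srevK q : involutive (@srev K q).
Proof. by move=> s; apply: simplex_eq => i; rewrite !srevE rev_ordK. Qed.

(** Reversal reindexes the fibres of [a] as those of [rev_dmap a]. *)
Lemma srev_push p q (a : dmap p q) (s : simplex K p) :
  srev (push a s) = push (rev_dmap a) (srev s).
Proof.
apply: simplex_eq => i; rewrite srevE !pushE [RHS](reindex_inj rev_ord_inj) /=.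
apply: eq_big => j; last by rewrite srevE rev_ordK.
by rewrite rev_ordK (can2_eq rev_ordK rev_ordK).
Qed.

(** The levels are left fixed and only the outer coordinates are reversed. An operator [a] of
    [tilde X] is [rev_dmap a] on [X], so [srev_push] matches the two gluings. *)
Lemma reversal (X : simplicial_cat) : exists G, @reverses K X G.
Proof.
have [||p q a u v s uv|G [cG GP]] := @realization_lift
  (level_realization K (tilde X)) (level_realization K X)
  (fun q => id) (fun q => @srev K q).
- by move=> q u; exact: cvg_id.
- exact: srev_continuous.
- by rewrite srev_push; apply: rpt_glue.
by exists G; split=> // q m x s t; rewrite /cat_rpt GP.
Qed.

Lemma cat_rpt_surj (X : simplicial_cat) (u : cat_realization K X) :
  exists q m (x : chain (X q) m) s t, u = cat_rpt x s t.
Proof.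
have [q [v [t ->]]] := rpt_surj u; have [m [x [s ->]]] := rpt_surj v.
by exists q, m, x, s, t.
Qed.

End RealizationMaps.

(** * Induced maps on loops and on the bar construction of the monoid *)

Section LoopMap.
Variables (K : realType) (X : topologicalType) (x : X) (b : X -> X).
Hypotheses (cb : continuous b) (bx : b x = x).

Lemma loop_map_cts (g : loop_space K x) : continuous (b \o loop_fun g).
Proof.
move=> s; apply: (@continuous_comp _ _ _ (loop_fun g) b); last exact: cb.
exact: cts_fun.
Qed.

Lemma loop_map0 (g : loop_space K x) : (b \o loop_fun g) zero = x.
Proof. by rewrite /= /loop_fun path_zero. Qed.

Lemma loop_map1 (g : loop_space K x) : (b \o loop_fun g) one = x.
Proof. by rewrite /= /loop_fun path_one. Qed.

Definition loop_map (g : loop_space K x) : loop_space K x :=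
  (mk_path (@loop_map_cts g) (loop_map0 g) (loop_map1 g)
    : {path unit_interval K from x to x}).

(** Loops carry the topology induced from the compact-open one, where postcomposition with [b] is
    continuous. *)
Lemma loop_map_continuous : continuous loop_map.
Proof.
have cF : continuous (fun g : loop_space K x =>
    loop_fun g : {compact-open, unit_interval K -> X}).
  exact: initial_continuous.
apply: continuous_comp_initial.
move=> g; apply: (@continuous_comp (loop_space K x)
  {compact-open, unit_interval K -> X} {compact-open, unit_interval K -> X}
  (fun g => loop_fun g) (postcomp b)); first exact: cF.
exact: postcomp_continuous.
Qed.

Lemma loop_mapK : involutive b -> involutive loop_map.
Proof. by move=> bK g; apply/path_eqP => s /=; rewrite -[RHS]bK. Qed.

End LoopMap.

Section GLmonoidBar.
Variables (K : realType) (R : bimonoidal).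
Variable m : GLmonoid K R -> GLmonoid K R.
Hypotheses (m_mul : forall a b c, GLmul a b c -> GLmul (m a) (m b) (m c))
  (m_one : m (GLone K R) = GLone K R) (m_cts : continuous m).

Lemma GLprod_map s a : GLprod s a -> GLprod (map m s) (m a).
Proof.
elim=> [|a0 s0 b c _ IH abc] /=; first by rewrite m_one; exact: GLprod_nil.
exact: GLprod_cons IH (m_mul abc).
Qed.

(** The endomorphism acts coordinatewise; faces multiply coordinates and degeneracies insert units,
    and [GLprod_map] covers both. *)
Lemma GLmonoid_bar_map : exists b : BGLmonoid K R -> BGLmonoid K R,
  @realizes K (GLmonoid_bar K R) (GLmonoid_bar K R) (fun p x i => m (x i)) b.
Proof.
apply: realization_map => [p|p q a x y xy i].
  apply: (@continuous_kelley {ptws 'I_p -> GLmonoid K R}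
    {ptws 'I_p -> GLmonoid K R} (fun x i => m (x i))).
  apply: continuous_ptws => i x.
  apply: (@continuous_comp {ptws 'I_p -> GLmonoid K R} _ _ (proj i) m).
    exact: proj_continuous.
  exact: m_cts.
by rewrite (map_comp m); exact/GLprod_map/xy.
Qed.

End GLmonoidBar.

Section GLmonoidTau.
Variables (K : realType) (R : bimonoidal) (Z : anti_involution R).
Variables (t : forall n, cat_realization K (BGL R n) ->
                         cat_realization K (tilde (BGL R n)))
  (r : forall n, cat_realization K (tilde (BGL R n)) ->
                 cat_realization K (BGL R n)).
Hypotheses (tP : forall n, cat_realizes (tau Z n) (@t n))
  (rP : forall n, reverses (@r n)).

Definition GLmonoid_tau (u : GLmonoid K R) : GLmonoid K R :=
  existT _ (projT1 u) (r (t (projT2 u))).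

(** Every point of the monoid has this form, so involutivity and multiplicativity are read off here.
    The nerve coordinates [s] are kept and only the bar coordinates [v] are reversed. *)
Lemma GLmonoid_tauE n q l (x : chain (BGL R n q) l) s v :
  GLmonoid_tau (existT _ n (cat_rpt x s v)) =
  existT _ n (cat_rpt (tau_chain Z x) s (srev v)).
Proof.
have [[_ tE] [_ rE]] := (tP n, rP n).
by rewrite /GLmonoid_tau /= tE rE.
Qed.

Lemma GLmonoid_tauK : involutive GLmonoid_tau.
Proof.
move=> [n u]; have [q [l [x [s [v ->]]]]] := cat_rpt_surj u.
by rewrite !GLmonoid_tauE tau_chainK srevK.
Qed.

Lemma GLmonoid_tau_continuous : continuous GLmonoid_tau.
Proof.
apply/continuousP => A oA; apply/sigT_openP => n.
suff /continuousP : continuous (GLmonoid_tau \o existT _ n) by apply.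
move=> u; apply: (@continuous_comp (cat_realization K (BGL R n))
  (cat_realization K (BGL R n)) (GLmonoid K R)
  (fun u => r (t u)) (existT _ n)); last exact: existT_continuous.
have [[ct _] [cr _]] := (tP n, rP n).
by apply: (@continuous_comp _ _ _ (@t n) (@r n)); [exact: ct|exact: cr].
Qed.

Lemma GLmonoid_tau_mul a b c : GLmul a b c ->
  GLmul (GLmonoid_tau a) (GLmonoid_tau b) (GLmonoid_tau c).
Proof.
move=> [n [m [q [l [x [y [z [s [v [xyz -> -> ->]]]]]]]]]].
exists n, m, q, l.
exists (tau_chain Z x), (tau_chain Z y), (tau_chain Z z), s, (srev v).
by split; rewrite ?GLmonoid_tauE //; exact: tau_block_sum.
Qed.

Lemma GLmonoid_tau_one : GLmonoid_tau (GLone K R) = GLone K R.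
Proof.
have pt : srev (point_simplex K) = point_simplex K.
  by apply: simplex_eq => i; rewrite srevE !ord1.
by rewrite /GLone GLmonoid_tauE tau_chain_point pt.
Qed.

End GLmonoidTau.

Theorem theorem4p8 (K : realType) (R : bimonoidal) (Z : anti_involution R) :
  exists tau : forall n q, functor (BGL R n q) (tilde (BGL R n) q),
    [/\ forall n q, is_tau Z (tau n q),
        forall n, simplicial_functor (tau n) &
        exists T : Ktheory K R -> Ktheory K R,
          [/\ continuous T, involutive T & induced_by tau T]].
Proof.
exists (tau Z); split; [exact: tau_is_tau|exact: tau_simplicial|].
pose t n := sval (cid (cat_realization_map K (tau_simplicial Z n))).
have tP n : cat_realizes (tau Z n) (t n) :=
  svalP (cid (cat_realization_map K (tau_simplicial Z n))).
pose r n := sval (cid (reversal K (BGL R n))).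
have rP n : reverses (r n) := svalP (cid (reversal K (BGL R n))).
have [b bP] := GLmonoid_bar_map (GLmonoid_tau_mul tP rP)
  (GLmonoid_tau_one tP rP) (GLmonoid_tau_continuous tP rP).
have [cb bE] := bP.
have bx : b (BGLmonoid_point K R) = BGLmonoid_point K R.
  (* In degree 0 the coordinates form an empty family, so the base point is fixed. *)
  by rewrite /BGLmonoid_point bE; congr rpt; apply/funext => -[].
have bK : involutive b.
  (* Each point is represented by a family in the monoid, on which [b] acts coordinatewise by an
     involution. *)
  move=> u; have [q [x [s ->]]] := rpt_surj u; rewrite !bE; congr rpt.
  by apply/funext => i; rewrite (GLmonoid_tauK tP rP).
exists (loop_map cb bx); split.
- exact: loop_map_continuous.
- exact: loop_mapK.
- by exists t, r, b.
Qed.
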